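(* Let $X=\{X_t;\ t\in\mathbf{R}_+\}$ be a multifractional Brownian motion with parameter function $H:\mathbf{R}_+\to(0,1)$ such that, for some open interval $I$, $$\forall t\in I;\quad H(t)<\tilde{\beta}(t),$$ where $\tilde{\beta}(t)$ is the local Hölder exponent of $H$ at $t$. Then, almost surely, for all $t_0\in I$, the $2$-microlocal frontier of $X$ at $t_0$ in the region $$D=\{(s',\sigma):\ -1<s'<0,\ 0<\sigma<1+s'\}$$ is equal to the line $\sigma=H(t_0)+s'$ (that is, the part of the graph of $\boldsymbol{\sigma}_{t_0}$ in $D$ coincides with the part of this line in $D$). In particular, almost surely, for all $t_0\in I$, $\boldsymbol{\alpha}(t_0)=\widetilde{\boldsymbol{\alpha}}(t_0)=H(t_0)$.
   Context: Multifractional Brownian motion (mBm) with function $H$ is the Gaussian process $$X_t=\int_{\mathbf{R}}\left[|t-u|^{H(t)-\frac12}-|u|^{H(t)-\frac12}\right]\mathbb{W}(du),$$ where $\mathbb{W}$ is the white noise of $\mathbf{R}$. The paper takes as known about mBm that it is Hölder-continuous but not differentiable and that its incremental variance satisfies: for each $t_0$ there are positive constants $K(t_0),L(t_0)$ such that, for $t,u\in B(t_0,\rho)$, $$E[(X_t-X_u)^2]=K(t_0)|t-u|^{2H(t)}+L(t_0)[H(t)-H(u)]^2+o\big(|t-u|^{2H(t)}\big)+o\big((H(t)-H(u))^2\big).$$ $B(t_0,\rho)$ is the ball of centre $t_0$ and radius $\rho$ in $\mathbf{R}_+=[0,\infty)$; suprema below are over $t\neq u$. The $2$-microlocal frontier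 of $X$ at $t_0$ is, for $s'\in(-\infty,0)$, $$\boldsymbol{\sigma}_{t_0}(s')=\sup\Big\{\sigma:\limsup_{\rho\to0}\sup_{t,u\in B(t_0,\rho)}\frac{|X_t-X_u|}{|t-u|^{\sigma}\rho^{-s'}}<\infty\Big\};$$ the pointwise and local Hölder exponents of $X$ at $t_0$ are $$\boldsymbol{\alpha}(t_0)=\sup\Big\{\alpha:\limsup_{\rho\to0}\sup_{t,u\in B(t_0,\rho)}\frac{|X_t-X_u|}{\rho^{\alpha}}<\infty\Big\},\quad \widetilde{\boldsymbol{\alpha}}(t_0)=\sup\Big\{\alpha:\limsup_{\rho\to0}\sup_{t,u\in B(t_0,\rho)}\frac{|X_t-X_u|}{|t-u|^{\alpha}}<\infty\Big\};$$ and $\tilde\beta(t_0)=\sup\{\beta:\limsup_{\rho\to0}\sup_{t,u\in B(t_0,\rho)}|H(t)-H(u)|/|t-u|^{\beta}<\infty\}$. *)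

(* Defs.v *)
From HB Require Import structures.
From mathcomp Require Import all_boot all_order all_algebra.
From mathcomp Require Import all_classical all_reals all_analysis.
Import Order.TTheory GRing.Theory Num.Theory.
Import numFieldNormedType.Exports.

Set Implicit Arguments.
Unset Strict Implicit.
Unset Printing Implicit Defensive.

Local Open Scope classical_set_scope.
Local Open Scope ring_scope.

(* Functions and processes on R_+ = [0, +oo[ are encoded as families indexed by
   R whose values at negative indices are never used. *)

Section Exponents.
Context {R : realType}.

Definition nonneg_ball (t0 rho : R) : set R :=
  ball t0 rho `&` [set t | 0 <= t].

(* sup of |f t - f u| / w |t - u| rho over t <> u in the ball *)
Definition increment_ratio (f : R -> R) (t0 : R) (w : R -> R -> R)
    (rho : R) : \bar R :=
  ereal_sup [set z | exists t u, [/\ nonneg_ball t0 rho t,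
    nonneg_ball t0 rho u, t != u &
    z = (`|f t - f u| / w `|t - u| rho)%:E]].

Definition limsup_finite (f : R -> R) (t0 : R) (w : R -> R -> R) : Prop :=
  (limf_esup (increment_ratio f t0 w) 0^'+ < +oo)%E.

Definition microlocal_frontier (f : R -> R) (t0 s' : R) : \bar R :=
  ereal_sup [set sigma%:E | sigma in
    [set sigma : R |
       limsup_finite f t0 (fun x rho => x `^ sigma * rho `^ (- s'))]].

Definition pointwise_exponent (f : R -> R) (t0 : R) : \bar R :=
  ereal_sup [set alpha%:E | alpha in
    [set alpha : R | limsup_finite f t0 (fun _ rho => rho `^ alpha)]].

Definition local_exponent (f : R -> R) (t0 : R) : \bar R :=
  ereal_sup [set alpha%:E | alpha in
    [set alpha : R | limsup_finite f t0 (fun x _ => x `^ alpha)]].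

(* Pairs are (s', sigma). *)
Definition frontier_graph (f : R -> R) (t0 : R) : set (R * R) :=
  [set p | microlocal_frontier f t0 p.1 = p.2%:E].

Definition region_D : set (R * R) :=
  [set p | -1 < p.1 < 0 /\ 0 < p.2 < 1 + p.1].

(* Interval that is open in R_+: an open interval, or [0, b[ with b <= +oo. *)
Definition open_interval_nonneg (I : set R) : Prop :=
  is_interval I /\
  exists U : set R, open U /\ I = U `&` [set t | 0 <= t].

End Exponents.

Section WhiteNoise.
Context {R : realType} {d : measure_display} {T : measurableType d}.
Variable P : probability T R.

(* Point masses are allowed; they are separated from normal_prob m s because
   the library's normal_prob m 0 is not a point mass. *)
Definition gaussian_rv (Y : T -> R) : Prop :=
  (exists m : R, {ae P, forall w, Y w = m}) \/
  (exists m s : R, s != 0 /\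
     forall V : set R, measurable V -> P (Y @^-1` V) = normal_prob m s V).

Definition gaussian_process (J : Type) (D : set J)
    (Y : J -> {RV P >-> R}) : Prop :=
  forall (n : nat) (a : 'I_n -> R) (j : 'I_n -> J), (forall i, D (j i)) ->
    gaussian_rv (fun w => \sum_(i < n) a i * Y (j i) w).

Definition finite_borel : set (set R) :=
  [set A | measurable A /\ (lebesgue_measure A < +oo)%E].

Definition white_noise (W : set R -> {RV P >-> R}) : Prop :=
  [/\ gaussian_process finite_borel W,
      forall A, finite_borel A -> ('E_P[W A] = 0)%E &
      forall A B, finite_borel A -> finite_borel B ->
        ('E_P[(fun w => W A w * W B w)%R] = lebesgue_measure (A `&` B)%classic)%E].

(* Y = \int f(u) W(du): simple functions approximate f in L^2(R) and their
   elementary integrals approximate Y in L^2(P), simultaneously. *)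
Definition wiener_integral (W : set R -> {RV P >-> R}) (f : R -> R)
    (Y : {RV P >-> R}) : Prop :=
  forall eps : R, 0 < eps ->
    exists (n : nat) (a : 'I_n -> R) (A : 'I_n -> set R),
      [/\ forall i, finite_borel (A i),
          (\int[lebesgue_measure]_u
             ((f u - \sum_(i < n) a i * \1_(A i) u) ^+ 2)%:E < eps%:E)%E &
          ('E_P[(fun w => (Y w - \sum_(i < n) a i * W (A i) w) ^+ 2)%R]
             < eps%:E)%E].

(* For h = 1/2 this kernel vanishes identically (0 `^ 0 = 1), so X t = 0 almost
   surely when H t = 1/2; the positivity of K in incremental_variance below
   rules this case out. *)
Definition mBm_kernel (h t u : R) : R :=
  `|t - u| `^ (h - 2^-1) - `|u| `^ (h - 2^-1).

(* Gaussianity of X is a consequence: L^2 limits of Gaussians are Gaussian. *)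
Definition mBm (W : set R -> {RV P >-> R}) (H : R -> R)
    (X : R -> {RV P >-> R}) : Prop :=
  forall t, 0 <= t -> wiener_integral W (mBm_kernel (H t) t) (X t).

(* Expansion at t0 of the incremental variance; the two remainders
   o(|t - u|^{2 H t}) and o((H t - H u)^2) are bounded together. *)
Definition incremental_variance (H : R -> R) (X : R -> {RV P >-> R})
    (t0 : R) : Prop :=
  exists K L : R, [/\ 0 < K, 0 < L &
    forall eps : R, 0 < eps -> \forall rho \near 0^'+,
      forall t u, nonneg_ball t0 rho t -> nonneg_ball t0 rho u ->
        (`| 'E_P[(fun w => (X t w - X u w) ^+ 2)%R]
            - (K * `|t - u| `^ (2 * H t) + L * (H t - H u) ^+ 2)%:E |
         <= (eps * (`|t - u| `^ (2 * H t) + (H t - H u) ^+ 2))%:E)%E].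

End WhiteNoise.

(* Main.v *)
(* The variance expansion says that near [t0] the process looks like a fractional
   Brownian motion of index [H t0]: since [H] is Hoelder of some order
   [beta > H t0], the term [(H t - H u)^2] is negligible with respect to
   [|t - u|^(2 H t)], uniformly in [t, u] close to [t0]. As the L^2 closure of the
   noise is Gaussian, this gives on the one hand high moments of the increments,
   hence, by dyadic chaining, Hoelder continuity of every order [g < H t0] near
   [t0]. On the other hand the increments [X (t + l^i rho) - X t], [i < n], have
   nearly diagonal correlations when [l] is small, so the probability that they
   are all smaller than [rho^alpha], [alpha > h > H t0], is
   [O(rho^(n (alpha - h)))]. For [n] large this beats the number [O(1/rho)] of grid
   points [t], so almost surely no point [t0] at all has a pointwise exponent
   greater than [H t0]. Almost sure statements are indexed by dyadic boxes and
   rational exponents, which are countably many. *)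
Require Import Defs.
From HB Require Import structures.
From mathcomp Require Import all_boot all_order all_algebra.
From mathcomp Require Import all_classical all_reals all_analysis.
From mathcomp Require Import measurable_realfun zify ring lra.
Import Order.TTheory GRing.Theory Num.Theory.
Import numFieldNormedType.Exports.
Set Implicit Arguments.
Unset Strict Implicit.
Unset Printing Implicit Defensive.
Local Open Scope classical_set_scope.
Local Open Scope ring_scope.

(** * Gaussian integrals *)

(** Two obstacles shape the proof. Each [X t] is only a mean-square limit of combinations of the
    noise, and Gaussianity is given for one real combination at a time. So no joint density appears:
    the mean cosines and the Laplace transforms of the combinations are computed, and only one-sided
    consequences, an upper bound on mean cosines and a tail bound, are carried to the limit, with
    lost constants. Small balls in dimension [n] are then estimated by a trigonometric polynomial,
    whose mean involves linear combinations only. The constants and the radius of the variance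
    expansion depend on the point in an uncontrolled way. Hence the almost sure estimates are
    conditional: on a given box, for given exponents, if some constant gives a variance bound, then
    the paths obey an estimate. The expansion at [t0] serves to find a box around [t0] that meets
    the condition, so the exceptional set is the same for all [t0]. The assumed path continuity
    carries the Hoelder bound from dyadic points to all points; the lower bound on oscillations
    looks at countably many points only. *)

Section integrable_EFin.
Context d (T : measurableType d) (R : realType) (mu : {measure set T -> \bar R}).
Implicit Types (D : set T) (f g : T -> R).

Lemma integrable_EFinD D f g : measurable D ->
  mu.-integrable D (EFin \o f) -> mu.-integrable D (EFin \o g) ->
  mu.-integrable D (EFin \o (fun x => f x + g x)).
Proof. by move=> mD; exact: integrableD. Qed.

Lemma integrable_EFinB D f g : measurable D ->
  mu.-integrable D (EFin \o f) -> mu.-integrable D (EFin \o g) ->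
  mu.-integrable D (EFin \o (fun x => f x - g x)).
Proof. by move=> mD; exact: integrableB. Qed.

Lemma integrable_EFinZl D f (k : R) : measurable D ->
  mu.-integrable D (EFin \o f) ->
  mu.-integrable D (EFin \o (fun x => k * f x)).
Proof. by move=> mD; exact: integrableZl. Qed.

Lemma integrable_EFin_sum D (I : finType) (p : pred I) (f : I -> T -> R) :
  measurable D -> (forall i, mu.-integrable D (EFin \o f i)) ->
  mu.-integrable D (EFin \o (fun x => \sum_(i | p i) f i x)).
Proof.
move=> mD intf.
apply: (eq_integrable mD (fun x => \sum_(i <- index_enum I | p i) (f i x)%:E)%E).
  by move=> x _; rewrite /= -sumEFin.
by apply: integrable_sum => // i _; exact: intf.
Qed.

Lemma Rintegral_sum D (I : finType) (p : pred I) (f : I -> T -> R) :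
  measurable D -> (forall i, mu.-integrable D (EFin \o f i)) ->
  \int[mu]_(x in D) (\sum_(i | p i) f i x) =
  \sum_(i | p i) \int[mu]_(x in D) f i x.
Proof.
move=> mD intf; rewrite /Rintegral.
under eq_integral do rewrite -sumEFin.
rewrite integral_sum//.
by rewrite sum_fine// => i _; apply: integrable_fin_num => //; exact: intf.
Qed.

End integrable_EFin.

Lemma Rintegral_cst_probability d (T : measurableType d) (R : realType)
  (P : probability T R) (c : R) : \int[P]_x c = c.
Proof. by rewrite Rintegral_cst//= probability_setT mulr1. Qed.

Section gaussian_integrals.
Context {R : realType}.
Local Notation mu := (@lebesgue_measure R).
Implicit Types (m s a l x : R).

(** Completing the square: an exponential tilt shifts the mean by [l * s ^+ 2]. The Laplace
    transform is the constant in front. *)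
Lemma expR_mul_normal_pdf m s l x : s != 0 ->
  expR (l * x) * normal_pdf m s x =
  expR (l * m + l ^+ 2 * s ^+ 2 / 2) * normal_pdf (m + l * s ^+ 2) s x.
Proof.
move=> s0; rewrite !normal_pdfE// /normal_fun mulrCA [RHS]mulrCA -!expRD.
congr (_ * expR _); field.
by rewrite s0.
Qed.

Lemma ge0_integral_normal_prob m s (f : R -> \bar R) :
  measurable_fun [set: R] f -> (forall x, 0 <= f x)%E ->
  (\int[normal_prob m s]_x f x = \int[mu]_x (f x * (normal_pdf m s x)%:E))%E.
Proof.
move=> mf f0.
have dom := @normal_prob_dominates R m s.
rewrite -(Radon_Nikodym_SigmaFinite.change_of_variables dom)//.
have mpdf : measurable_fun [set: R] (fun x => (normal_pdf m s x)%:E).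
  by apply/measurable_EFinP; exact: measurable_normal_pdf.
have mrn : measurable_fun [set: R] (Radon_Nikodym_SigmaFinite.f (normal_prob m s) mu).
  apply: (measurable_int mu).
  exact: Radon_Nikodym_SigmaFinite.f_integrable.
apply: ae_eq_integral => //.
- exact: emeasurable_funM.
- exact: emeasurable_funM.
apply: ae_eqe_mul2l; apply: integral_ae_eq => //.
- exact: Radon_Nikodym_SigmaFinite.f_integrable.
- move=> E _ mE; rewrite -Radon_Nikodym_SigmaFinite.f_integral//.
Qed.

Lemma integral_expR_normal_prob m s l : s != 0 ->
  (\int[normal_prob m s]_x (expR (l * x))%:E =
   (expR (l * m + l ^+ 2 * s ^+ 2 / 2))%:E)%E.
Proof.
move=> s0; rewrite ge0_integral_normal_prob.
- under eq_integral do rewrite -EFinM expR_mul_normal_pdf// EFinM.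
  rewrite ge0_integralZl//.
  + by rewrite integral_normal_pdf mule1.
  + by apply/measurable_EFinP; exact: measurable_normal_pdf.
  + by move=> x _; rewrite lee_fin normal_pdf_ge0.
- by apply/measurable_EFinP; apply: measurableT_comp => //; exact: measurable_funM.
- by move=> x; rewrite lee_fin expR_ge0.
Qed.

(** The dominating function is integrable by the Laplace transform at 1 and -1, and it is large
    enough for the linear and trigonometric integrands below. *)
Lemma normal_prob_integrable m s (f : R -> R) : s != 0 -> measurable_fun [set: R] f ->
  (forall x, `|f x| <= expR x + expR (- x)) ->
  (normal_prob m s).-integrable setT (EFin \o f).
Proof.
move=> s0 mf hf.
have iexp l : (normal_prob m s).-integrable setT (fun x => (expR (l * x))%:E).
  apply/integrableP; split.
    by apply/measurable_EFinP; apply: measurableT_comp => //; exact: measurable_funM.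
  under eq_integral do rewrite gee0_abs ?lee_fin ?expR_ge0//.
  by rewrite integral_expR_normal_prob// ltry.
apply: (le_integrable measurableT _ _ (integrableD measurableT (iexp 1) (iexp (-1)))).
  exact/measurable_EFinP.
by move=> x _; rewrite /= lee_fin mul1r mulN1r [leRHS]ger0_norm//.
Qed.

Lemma normr_le_expRD x : `|x| <= expR x + expR (- x).
Proof.
have h (y : R) : y <= expR y by rewrite (le_trans _ (expR_ge1Dx y))// lerDr.
have [x0|x0] := leP 0 x.
  by rewrite ger0_norm// (le_trans (h x))// lerDl expR_ge0.
by rewrite ltr0_norm// (le_trans (h (- x)))// lerDr expR_ge0.
Qed.

Lemma one_le_expRD x : 1 <= expR x + expR (- x).
Proof.
have := expR_ge1Dx x; have := expR_ge1Dx (- x).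
by lra.
Qed.

End gaussian_integrals.

(** * Integration by parts for the normal law *)

Section gaussian_ibp.
Context {R : realType}.
Local Notation mu := (@lebesgue_measure R).
Implicit Types (m s a l x : R).

(** Meant for boundary terms at [n] and [- n]: [y ^+ 2 >= y - 1] turns the Gaussian decay into a
    geometric one. *)
Lemma normal_pdf_le_geometric m s : s != 0 -> exists2 C : R, 0 <= C &
  forall x n, `|x| = n%:R ->
  normal_pdf m s x <= C * expR (- (s ^+ 2 *+ 2)^-1) ^+ n.
Proof.
move=> s0; exists (normal_peak s * expR ((`|m| + 1) / (s ^+ 2 *+ 2))).
  by rewrite mulr_ge0 ?expR_ge0 ?normal_peak_ge0.
move=> x n xn; rewrite normal_pdfE// /normal_fun -expRM_natl -mulrA -expRD.
rewrite ler_wpM2l ?normal_peak_ge0// ler_expR mulrN -mulrBl.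
have s2 : 0 < s ^+ 2 *+ 2 by rewrite pmulrn_lgt0// exprn_even_gt0.
rewrite ler_pM2r ?invr_gt0// -xn -real_normK ?num_real//.
have : `|x| - `|m| <= `|x - m| by exact: lerB_dist.
have := normr_ge0 (x - m); set y := `|x - m|; nra.
Qed.

Lemma is_derive_normal_pdf m s x : s != 0 ->
  is_derive x 1 (normal_pdf m s) (- (x - m) / s ^+ 2 * normal_pdf m s x).
Proof.
move=> s0; rewrite normal_pdfE// /normal_fun.
have h : is_derive x 1 (fun x : R => - (x - m) ^+ 2 / (s ^+ 2 *+ 2)) (- (x - m) / s ^+ 2).
  apply: is_derive_eq.
  by rewrite /GRing.scale /=; field.
have h3 := is_deriveZ (normal_peak s) (is_derive1_comp (is_derive_expR _) h).
apply: (is_derive_eq h3).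
by rewrite /GRing.scale /= mulrA mulrC.
Qed.

Lemma integral_normal_prob m s (f : R -> R) :
  (normal_prob m s).-integrable setT (EFin \o f) ->
  (\int[normal_prob m s]_x (f x)%:E = \int[mu]_x (f x * normal_pdf m s x)%:E)%E.
Proof.
move=> intf; have dom := @normal_prob_dominates R m s.
rewrite -(Radon_Nikodym_change_of_variables dom)//=.
have mf : measurable_fun [set: R] (EFin \o f) by exact: (measurable_int _ intf).
have mp : measurable_fun [set: R] (fun x => (normal_pdf m s x)%:E).
  by apply/measurable_EFinP; exact: measurable_normal_pdf.
under [RHS]eq_integral do rewrite EFinM.
apply: ae_eq_integral => //.
- by apply: emeasurable_funM.
- exact: emeasurable_funM.
- apply: ae_eqe_mul2l => /=.
  rewrite Radon_NikodymE//=.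
  case: cid => /= h [h1 h2 h3].
  apply: integral_ae_eq => //=.
  by move=> E E01 mE; rewrite -h3.
Qed.

Lemma integrable_normal_prob_mu m s (f : R -> R) :
  (normal_prob m s).-integrable setT (EFin \o f) ->
  mu.-integrable setT (fun x => (f x * normal_pdf m s x)%:E).
Proof.
case/integrableP => mf foo; apply/integrableP; split.
  apply/measurable_EFinP; apply: measurable_funM; last exact: measurable_normal_pdf.
  exact/measurable_EFinP.
rewrite ge0_integral_normal_prob in foo; last 2 first.
- exact: measurableT_comp.
- by move=> x; exact: abse_ge0.
apply: le_lt_trans foo; rewrite le_eqVlt; apply/orP; left; apply/eqP.
apply: eq_integral => x _ /=.
by rewrite normrM (ger0_norm (normal_pdf_ge0 _ _ _)).
Qed.

Lemma cvg_integral_symitv (f : R -> R) : mu.-integrable setT (EFin \o f) ->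
  (\int[mu]_(x in `[(- n%:R)%R, n%:R%R]) (f x)%:E)%E @[n --> \oo] --> (\int[mu]_x (f x)%:E)%E.
Proof.
move=> intf.
under eq_fun do rewrite integral_mkcond.
have mf : measurable_fun setT (EFin \o f) by exact: (measurable_int mu).
have [] := @dominated_convergence _ _ _ mu setT measurableT
  (fun n => (EFin \o f) \_ `[- n%:R, n%:R]) (EFin \o f) (fun x => `|(f x)%:E|%E) _ mf.
- move=> n; apply/(measurable_restrictT _ _).1 => //.
  exact: measurable_funTS.
- apply: aeW => x _; apply: cvg_near_cst.
  near=> n; rewrite patchE mem_set//= in_itv/= -ler_norml.
  near: n; exact: nbhs_infty_ger.
- exact: integrable_abse.
- apply: aeW => x n _; rewrite patchE; case: ifP => //=.
  by rewrite normr0 lee_fin.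
by [].
Unshelve. end_near. Qed.


(** Stein's identity. Times the density, the integrand is the derivative of [b * normal_pdf m s],
    whose values at [n] and [- n] tend to 0 because [b] is bounded. *)
Lemma normal_prob_ibp m s (b b' : R -> R) : s != 0 ->
  (forall x, is_derive x 1 b (b' x)) -> continuous b' ->
  (forall x, `|b x| <= 1) ->
  (normal_prob m s).-integrable setT (fun x => (b' x - b x * (x - m) / s ^+ 2)%:E) ->
  (\int[normal_prob m s]_x (b' x - b x * (x - m) / s ^+ 2)%:E = 0)%E.
Proof.
move=> s0 db cb' b1 intf; rewrite integral_normal_prob//.
pose F x := b x * normal_pdf m s x.
pose f x := (b' x - b x * (x - m) / s ^+ 2) * normal_pdf m s x.
have dF x : is_derive x 1 F (f x).
  apply: (is_derive_eq (is_deriveM (db x) (is_derive_normal_pdf m x s0))).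
  by rewrite /GRing.scale /= /f; field.
have cb : continuous b by move=> x; apply/differentiable_continuous/derivable1_diffP.
have cF : continuous F by move=> x; apply/differentiable_continuous/derivable1_diffP.
have cf : continuous f.
  move=> x; apply: cvgM; last exact: continuous_normal_pdf.
  apply: cvgB; first exact: cb'.
  apply: cvgM; last exact: cvg_cst.
  apply: cvgM; first exact: cb.
  by apply: cvgB; [exact: cvg_id|exact: cvg_cst].
have intmu : mu.-integrable setT (EFin \o f).
  exact: (integrable_normal_prob_mu intf).
have step (n : nat) : (0 < n)%N ->
    (\int[mu]_(x in `[(- n%:R)%R, n%:R%R]) (f x)%:E = (F n%:R%R - F (- n%:R)%R)%:E)%E.
  move=> n0; rewrite (@continuous_FTC2 _ f F)//.
  - by rewrite (@lt_trans _ _ 0)// ?oppr_lt0 ltr0n.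
  - exact: continuous_subspaceT.
  - split=> [x _||]; [exact: ex_derive| |].
    + apply: cvg_at_right_filter; exact: cF.
    + apply: cvg_at_left_filter; exact: cF.
  - by move=> x _; rewrite derive1E; apply: derive_val.
have lim0 : (F n%:R - F (- n%:R))%:E @[n --> \oo] --> 0%E.
  have [C C0 hC] := normal_pdf_le_geometric m s0.
  set q := expR _ in hC.
  apply: cvg_EFin; first exact: nearW.
  apply: norm_cvg0; apply: (@squeeze_cvgr _ _ _ _ (cst 0) (fun n => (C *+ 2) * q ^+ n)).
  - apply: nearW => n; rewrite /= normr_ge0/=.
    have Fle x : `|x| = n%:R -> `|F x| <= C * q ^+ n.
      move=> xn; rewrite /F normrM (ger0_norm (normal_pdf_ge0 _ _ _)).
      rewrite (le_trans _ (hC x n xn))// ler_piMl// normal_pdf_ge0//.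
    rewrite (le_trans (ler_normB _ _))// mulr2n mulrDl.
    by rewrite lerD// Fle ?normrN// normr_nat.
  - exact: cvg_cst.
  - rewrite -[X in _ --> X](mulr0 (C *+ 2)).
    apply: cvgM; first exact: cvg_cst.
    apply: cvg_expr; rewrite ger0_norm ?expR_ge0// expR_lt1 oppr_lt0 invr_gt0.
    by rewrite pmulrn_lgt0// exprn_even_gt0.
apply: (cvg_unique _ (cvg_integral_symitv intmu)) => //.
apply: cvg_trans lim0; apply: near_eq_cvg; near=> n.
by rewrite /= step//; near: n; exists 1%N.
Unshelve. end_near. Qed.

End gaussian_ibp.

(** * Mean and characteristic function of the normal law *)

Section gaussian_char.
Context {R : realType}.
Implicit Types (m s a l x : R).

Lemma measurable_cosM a : measurable_fun [set: R] (fun x : R => cos (a * x)).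
Proof.
apply: continuous_measurable_fun => x; apply: (continuous_comp (f := fun x => a * x)).
  by apply: mulrl_continuous.
exact: continuous_cos.
Qed.

Lemma normal_prob_mean m s : s != 0 -> (\int[normal_prob m s]_x x)%R = m.
Proof.
move=> s0.
have i1 : (normal_prob m s).-integrable setT (EFin \o (fun x : R => x)).
  by apply: normal_prob_integrable => //; exact: normr_le_expRD.
have ic (c : R) : (normal_prob m s).-integrable setT (EFin \o (fun x : R => c)).
  by apply: finite_measure_integrable_cst.
have i2 : (normal_prob m s).-integrable setT (EFin \o (fun x : R => x - m)).
  exact: integrable_EFinB.
have i3 : (normal_prob m s).-integrable setT
    (fun x : R => (0 - 1 * (x - m) / s ^+ 2)%:E).
  rewrite [X in integrable _ _ X](_ : _ = EFin \o (fun x => - s ^- 2 * (x - m))).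
    exact: integrable_EFinZl.
  by apply/funext => x; congr (_%:E); field.
(* Stein's identity for the constant function 1: [x - m] has mean zero. *)
have h : (\int[normal_prob m s]_x (0 - 1 * (x - m) / s ^+ 2)%:E = 0)%E.
  apply: (@normal_prob_ibp R m s (cst 1) (cst 0) s0 _ _ _ i3) => x /=.
  - exact: cvg_cst.
  - by rewrite normr1.
have -> : \int[normal_prob m s]_x x = \int[normal_prob m s]_x (x - m) + m.
  by rewrite RintegralB// (Rintegral_cst_probability (normal_prob m s)) subrK.
have : (\int[normal_prob m s]_x (- s ^- 2 * (x - m))) = 0.
  rewrite /Rintegral; under eq_integral => x _.
    rewrite (_ : - _ * _ = 0 - 1 * (x - m) / s ^+ 2); last by field.
    over.
  by rewrite h.
rewrite RintegralZl// => /eqP; rewrite mulf_eq0 oppr_eq0 invr_eq0 expf_eq0/= (negbTE s0)/=.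
by move=> /eqP ->; rewrite add0r.
Qed.

Section char.
Variables (s : R) (s0 : s != 0).
Let nu : probability (measurableTypeR R) R := normal_prob 0 s.
Let g a := \int[nu]_x cos (a * x).

Let msin a : measurable_fun [set: R] (fun x : R => sin (a * x)).
Proof.
apply: continuous_measurable_fun => x; apply: (continuous_comp (f := fun x => a * x)).
  by apply: mulrl_continuous.
exact: continuous_sin.
Qed.

Let icos a : nu.-integrable setT (EFin \o (fun x => cos (a * x))).
Proof.
apply: normal_prob_integrable => // [|x]; first exact: measurable_cosM.
exact: le_trans (cos_max _) (one_le_expRD _).
Qed.

Let ixsin a : nu.-integrable setT (EFin \o (fun x => x * sin (a * x))).
Proof.
apply: normal_prob_integrable => // [|x].
  by apply: measurable_funM.
rewrite normrM (le_trans _ (normr_le_expRD _))// ler_piMr//.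
exact: sin_max.
Qed.

Let dcos a x : is_derive a 1 (fun a => cos (a * x)) (- (x * sin (a * x))).
Proof.
have h : is_derive a 1 (fun a : R => a * x) x.
  by apply: is_derive_eq; rewrite /GRing.scale /=; ring.
apply: (is_derive_eq (is_derive1_comp (is_derive_cos _) h)).
by rewrite mulrC mulrN.
Qed.

Let dsin a x : is_derive x 1 (fun x => sin (a * x)) (a * cos (a * x)).
Proof.
have h : is_derive x 1 (fun x : R => a * x) a.
  by apply: is_derive_eq; rewrite /GRing.scale /=; ring.
apply: (is_derive_eq (is_derive1_comp (is_derive_sin _) h)).
by rewrite mulrC.
Qed.

(** Stein's identity for [sin (a * x)] turns the moment produced by differentiating [g] back into
    [g]. *)
Let xsinE a : \int[nu]_x (x * sin (a * x)) = a * s ^+ 2 * g a.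
Proof.
have i3 : nu.-integrable setT
    (fun x : R => (a * cos (a * x) - sin (a * x) * (x - 0) / s ^+ 2)%:E).
  rewrite [X in integrable _ _ X](_ : _ =
      EFin \o (fun x => a * cos (a * x) - s ^- 2 * (x * sin (a * x)))).
    by apply: integrable_EFinB => //; exact: integrable_EFinZl.
  by apply/funext => x; congr (_%:E); field.
have := normal_prob_ibp s0 (dsin a) _ (fun x => sin_max _) i3.
have cc : continuous (fun x : R => a * cos (a * x)).
  move=> x; apply: cvgM; first exact: cvg_cst.
  apply: (continuous_comp (f := fun x => a * x)).
    by apply: mulrl_continuous.
  exact: continuous_cos.
move=> /(_ cc) h.
have : \int[nu]_x (a * cos (a * x) - s ^- 2 * (x * sin (a * x))) = 0.
  rewrite /Rintegral; under eq_integral => x _.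
    rewrite (_ : a * _ - _ = a * cos (a * x) - sin (a * x) * (x - 0) / s ^+ 2); last by field.
    over.
  by rewrite h.
rewrite RintegralB//; last 2 first.
- exact: integrable_EFinZl.
- exact: integrable_EFinZl.
rewrite !RintegralZl// => /eqP; rewrite subr_eq0 => /eqP e.
rewrite -/(g a) in e.
apply: (mulfI (x := s ^- 2)); first by rewrite invr_eq0 expf_eq0.
by rewrite -e; field.
Qed.

(* Integration by parts: the characteristic function solves [g' = - a s^2 g]. *)
Let dg a : is_derive a 1 g (- (a * s ^+ 2 * g a)).
Proof.
pose f (a x : R) := cos (a * x).
have p1 (b x : R) : partial1of2 f b x = - (x * sin (b * x)).
  by rewrite partial1of2E; have [_ ->] := dcos b x.
have Ia : `]a - 1, a + 1[%classic a.
  by rewrite /= in_itv/= ltrDl ltrBlDr ltrDl ltr01.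
have iG : nu.-integrable setT (EFin \o (fun x : R => `|x|)).
  apply: normal_prob_integrable => // x.
  by rewrite normr_id; exact: normr_le_expRD.
have G0 (x : R) : 0 <= `|x| by [].
have ub b x : `]a - 1, a + 1[%classic b -> setT x -> `|partial1of2 f b x| <= `|x|.
  move=> _ _; rewrite p1 normrN normrM ler_piMr//.
  exact: sin_max.
have df (b x : R) : `]a - 1, a + 1[%classic b -> setT x -> derivable (f^~ x) b 1.
  by move=> _ _; have [] := dcos b x.
have D := derivable_under_integral measurableT Ia (fun b _ => icos b) df G0 iG ub.
have E := differentiation_under_integral measurableT Ia (fun b _ => icos b) df G0 iG ub.
apply: DeriveDef; first exact: D.
rewrite -derive1E; apply: (etrans E).
under eq_Rintegral do rewrite p1 -mulN1r.
by rewrite RintegralZl// xsinE mulN1r.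
Qed.

Lemma normal_prob_cos a : \int[nu]_x cos (a * x) = expR (- (a ^+ 2 * s ^+ 2 / 2)).
Proof.
(* Integrating factor: by the differential equation of [g], [k] has derivative 0, and its value at 0
   is 1. *)
pose k b := g b * expR (b ^+ 2 * s ^+ 2 / 2).
have dk (b : R) : is_derive b 1 k 0.
  have h : is_derive b 1 (fun b : R => b ^+ 2 * s ^+ 2 / 2) (b * s ^+ 2).
    by apply: is_derive_eq; rewrite /GRing.scale /=; field.
  apply: (is_derive_eq (is_deriveM (dg b) (is_derive1_comp (is_derive_expR _) h))).
  by rewrite /GRing.scale /=; ring.
have := is_derive_0_is_cst a 0 dk.
rewrite /k expr0n/= mul0r mul0r expR0 mulr1.
have -> : g 0 = 1.
  rewrite /g; under eq_Rintegral do rewrite mul0r cos0.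
  exact: (Rintegral_cst_probability nu 1).
have e0 : expR (a ^+ 2 * s ^+ 2 / 2) != 0 by rewrite gt_eqF// expR_gt0.
by move=> h; apply: (mulIf e0); rewrite expRN mulVf//.
Qed.

End char.
End gaussian_char.

(** * Expectations of random variables with a normal law *)

Section law.
Context d (T : measurableType d) (R : realType) (P : probability T R).
Implicit Types (Y G : T -> R) (a l m s v : R).

Lemma integrable_bounded Y (C : R) : measurable_fun setT Y ->
  (forall w, `|Y w| <= C) -> P.-integrable setT (EFin \o Y).
Proof.
move=> mY YC; apply: measurable_bounded_integrable => //.
  by apply: fin_num_fun_lty; exact: fin_num_measure.
exists C; split; first exact: num_real.
move=> M CM w _; exact: le_trans (YC w) (ltW CM).
Qed.

Lemma integrable_cosM Y a : measurable_fun setT Y ->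
  P.-integrable setT (EFin \o (fun w => cos (a * Y w))).
Proof.
move=> mY; apply: (@integrable_bounded _ 1) => [|w]; last exact: cos_max.
exact: (measurableT_comp (measurable_cosM a)).
Qed.

Lemma integrable_cos Y : measurable_fun setT Y ->
  P.-integrable setT (EFin \o (fun w => cos (Y w))).
Proof.
move=> mY; apply: (eq_integrable measurableT (EFin \o (fun w => cos (1 * Y w)))).
  by move=> w _; rewrite /= mul1r.
exact: integrable_cosM.
Qed.

Section normal_law.
Variables (Y : T -> R) (m s : R).
Hypothesis mY : measurable_fun setT Y.
Hypothesis lawY : forall V : set R, measurable V -> P (Y @^-1` V) = normal_prob m s V.

Lemma ge0_integral_law (f : R -> \bar R) : measurable_fun [set: R] f ->
  (forall x, 0 <= f x)%E ->
  (\int[P]_w f (Y w) = \int[normal_prob m s]_x f x)%E.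
Proof.
move=> mf f0.
rewrite -[LHS](@ge0_integral_pushforward _ _ T (measurableTypeR R) R Y mY P setT f)//.
apply: eq_measure_integral => A mA _; exact: lawY.
Qed.

Lemma integrable_law (f : R -> R) : (normal_prob m s).-integrable setT (EFin \o f) ->
  P.-integrable setT (EFin \o (f \o Y)).
Proof.
case/integrableP => mf foo; apply/integrableP; split.
  exact: (measurableT_comp mf).
rewrite (@ge0_integral_law (fun x => `|(f x)%:E|%E))//.
exact: measurableT_comp.
Qed.

Lemma Rintegral_law (f : R -> R) : (normal_prob m s).-integrable setT (EFin \o f) ->
  \int[P]_w f (Y w) = \int[normal_prob m s]_x f x.
Proof.
move=> intf; rewrite /Rintegral; congr fine.
rewrite -[LHS](@integral_pushforward _ _ T (measurableTypeR R) R Y mY P setT (EFin \o f))//.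
- by apply: eq_measure_integral => A mA _; exact: lawY.
- exact: (measurable_int _ intf).
- exact: integrable_law.
Qed.

End normal_law.

(* Transforms rather than a density, so that point masses ([v = 0]) are included. *)
Definition centered_gaussian G v := [/\ 0 <= v,
  (forall a, \int[P]_w cos (a * G w) = expR (- (a ^+ 2 * v / 2))) &
  (forall l, \int[P]_w (expR (l * G w))%:E = (expR (l ^+ 2 * v / 2))%:E)%E].

(** A zero mean forces [m = 0] in both cases of [gaussian_rv]; the witness is 0 for a point mass and
    [s ^+ 2] otherwise. *)
Lemma gaussian_rv_centered G : measurable_fun setT G -> gaussian_rv P G ->
  (\int[P]_w (G w)%:E = 0)%E -> exists v, centered_gaussian G v.
Proof.
move=> mG [[m Gm]|[m [s [s0 lawG]]]] G0.
  have m0 : m = 0.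
    have : (\int[P]_w (G w)%:E = \int[P]_w m%:E)%E.
      apply: ae_eq_integral => //; first exact/measurable_EFinP.
      by apply: filterS Gm => w -> _.
    rewrite G0 integral_cst//= probability_setT mule1 => -[] //.
  exists 0; split => // [a|l].
    rewrite mulr0 mul0r oppr0 expR0 /Rintegral.
    rewrite (ae_eq_integral (cst 1%E))//.
    + by rewrite integral_cst//= probability_setT mule1.
    + exact: (measurable_int _ (integrable_cosM a mG)).
    + by apply: filterS Gm => w -> _; rewrite m0 mulr0 cos0.
  rewrite mulr0 mul0r expR0 (ae_eq_integral (cst 1%E))//.
  + by rewrite integral_cst//= probability_setT mule1.
  + apply/measurable_EFinP; apply: measurableT_comp => //; exact: measurable_funM.
  + by apply: filterS Gm => w -> _; rewrite m0 mulr0 expR0.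
have m0 : m = 0.
  have im : (normal_prob m s).-integrable setT (EFin \o (fun x : R => x)).
    by apply: normal_prob_integrable => //; exact: normr_le_expRD.
  have := Rintegral_law mG lawG im.
  by rewrite normal_prob_mean// /Rintegral G0.
subst m; exists (s ^+ 2); split; first exact: sqr_ge0.
- move=> a; rewrite (@Rintegral_law _ _ _ mG lawG (fun x => cos (a * x))).
    exact: normal_prob_cos.
  apply: normal_prob_integrable => //; first exact: measurable_cosM.
  by move=> x; exact: le_trans (cos_max _) (one_le_expRD _).
- move=> l; rewrite (@ge0_integral_law _ _ _ mG lawG (fun x => (expR (l * x))%:E)).
  + by rewrite integral_expR_normal_prob// mulr0 add0r.
  + by apply/measurable_EFinP; apply: measurableT_comp => //; exact: measurable_funM.
  + by move=> x; rewrite lee_fin expR_ge0.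
Qed.

(** Markov's inequality with a free test function [f]: it serves the Chernoff, Chebyshev and
    small-ball bounds alike. *)
Lemma measure_le_Rintegral (A : set T) (f : T -> R) (c : R) : measurable A ->
  P.-integrable setT (EFin \o f) -> (forall w, 0 <= f w) ->
  (forall w, A w -> c <= f w) -> 0 < c -> (P A <= (\int[P]_w f w / c)%:E)%E.
Proof.
move=> mA intf f0 Af c0.
rewrite EFinM muleC lee_pdivlMl// /Rintegral fineK; last exact: integrable_fin_num.
have -> : (c%:E * P A = \int[P]_w (c * \1_A w)%:E)%E.
  under eq_integral do rewrite EFinM.
  by rewrite ge0_integralZl// ?integral_indic ?setIT// ?lee_fin ?ltW//; exact/measurable_EFinP.
apply: ge0_le_integral => //.
- by move=> w _; rewrite lee_fin mulr_ge0// ltW.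
- by apply/measurable_EFinP/measurable_funM.
- exact: (measurable_int _ intf).
- move=> w _; rewrite lee_fin indicE; have [wA|wA] := boolP (w \in A).
    by rewrite mulr1 Af//; exact/set_mem.
  by rewrite mulr0.
Qed.

End law.

(** * The Gaussian space of the noise *)

Section L2.
Context d (T : measurableType d) (R : realType) (P : probability T R).
Implicit Types (Y Z G : T -> R) (a l v : R).

Definition L2 Z := measurable_fun setT Z /\
  P.-integrable setT (EFin \o (fun w => Z w ^+ 2)).

Definition msq Z := \int[P]_w (Z w ^+ 2).

Lemma msq_ge0 Z : 0 <= msq Z.
Proof. by apply: Rintegral_ge0 => w _; exact: sqr_ge0. Qed.

Lemma le_integrable_real Y Z : measurable_fun setT Y ->
  P.-integrable setT (EFin \o Z) -> (forall w, `|Y w| <= Z w) ->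
  P.-integrable setT (EFin \o Y).
Proof.
move=> mY iZ YZ; apply: (le_integrable measurableT _ _ iZ).
  exact/measurable_EFinP.
move=> w _; rewrite /= lee_fin (le_trans (YZ w))//.
exact: ler_norm.
Qed.

Lemma L2_mul Y Z : L2 Y -> L2 Z -> P.-integrable setT (EFin \o (fun w => Y w * Z w)).
Proof.
move=> [mY iY] [mZ iZ].
apply: (le_integrable_real _ (integrable_EFinD measurableT iY iZ)).
  exact: measurable_funM.
move=> w; rewrite normrM -[Y w ^+ 2]real_normK ?num_real// -[Z w ^+ 2]real_normK ?num_real//.
have := sqr_ge0 (`|Y w| - `|Z w|); have := normr_ge0 (Y w); have := normr_ge0 (Z w).
by nra.
Qed.

Lemma L2_cst (c : R) : L2 (fun=> c).
Proof.
by split; [exact: measurable_cst|exact: finite_measure_integrable_cst].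
Qed.

Lemma L2_integrable Z : L2 Z -> P.-integrable setT (EFin \o Z).
Proof.
move=> Z2; apply: (eq_integrable measurableT (EFin \o (fun w => Z w * 1))).
  by move=> w _; rewrite /= mulr1.
exact: L2_mul (L2_cst 1).
Qed.

Lemma L2D Y Z : L2 Y -> L2 Z -> L2 (fun w => Y w + Z w).
Proof.
move=> Y2 Z2; split; first by apply: measurable_funD; [case: Y2|case: Z2].
apply: (eq_integrable measurableT (EFin \o (fun w => Y w ^+ 2 + (2 * (Y w * Z w) + Z w ^+ 2)))).
  by move=> w _ /=; congr (_%:E); ring.
apply: integrable_EFinD => //; first by case: Y2.
apply: integrable_EFinD => //; last by case: Z2.
by apply: integrable_EFinZl => //; exact: L2_mul.
Qed.

Lemma L2Z (c : R) Z : L2 Z -> L2 (fun w => c * Z w).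
Proof.
move=> [mZ iZ]; split; first exact: measurable_funM.
apply: (eq_integrable measurableT (EFin \o (fun w => c ^+ 2 * Z w ^+ 2))).
  by move=> w _ /=; rewrite exprMn.
exact: integrable_EFinZl.
Qed.

Lemma L2B Y Z : L2 Y -> L2 Z -> L2 (fun w => Y w - Z w).
Proof.
move=> Y2 Z2; rewrite (_ : (fun w => _) = fun w => Y w + (-1) * Z w).
  by apply: L2D => //; exact: L2Z.
by apply/funext => w; rewrite mulN1r.
Qed.

Lemma L2_sum n (Y : 'I_n -> T -> R) : (forall i, L2 (Y i)) ->
  L2 (fun w => \sum_(i < n) Y i w).
Proof.
elim: n Y => [|n IH] Y hY.
  rewrite (_ : (fun w => _) = fun=> 0); first exact: L2_cst.
  by apply/funext => w; rewrite big_ord0.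
rewrite (_ : (fun w => _) = fun w => \sum_(i < n) Y (widen_ord (leqnSn n) i) w + Y ord_max w).
  by apply: L2D => //; exact: IH.
by apply/funext => w; rewrite big_ord_recr.
Qed.

Lemma L2_fin Z : measurable_fun setT Z ->
  (\int[P]_w (Z w ^+ 2)%:E < +oo)%E -> L2 Z.
Proof.
move=> mZ Zoo; split => //; apply/integrableP; split.
  by apply/measurable_EFinP; exact: measurable_funX.
by under eq_integral do rewrite /= ger0_norm ?sqr_ge0//.
Qed.

Lemma msqE Z : L2 Z -> (\int[P]_w (Z w ^+ 2)%:E)%E = (msq Z)%:E.
Proof.
by move=> [_ iZ]; rewrite /msq /Rintegral fineK//; exact: integrable_fin_num.
Qed.

(** Cheaper than Minkowski's inequality; the factors 2 lost here are one source of the constants 8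
    and 64 below. *)
Lemma msqD_le Y Z : L2 Y -> L2 Z ->
  msq (fun w => Y w + Z w) <= 2 * msq Y + 2 * msq Z.
Proof.
move=> Y2 Z2; rewrite /msq -!RintegralZl//; [|by case: Z2|by case: Y2].
have [_ iY] := Y2; have [_ iZ] := Z2; have [_ iYZ] := L2D Y2 Z2.
have i1 := integrable_EFinZl 2 measurableT iY; have i2 := integrable_EFinZl 2 measurableT iZ.
rewrite -RintegralD//; apply: le_Rintegral => //.
  exact: integrable_EFinD.
move=> w _; have := sqr_ge0 (Y w - Z w); nra.
Qed.

Lemma msqZ (c : R) Z : L2 Z -> msq (fun w => c * Z w) = c ^+ 2 * msq Z.
Proof.
move=> [_ iZ]; rewrite /msq -RintegralZl//.
by apply: eq_Rintegral => w _; rewrite exprMn.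
Qed.

Lemma msq_close Y Z : L2 Y -> L2 (fun w => Z w - Y w) ->
  L2 Z /\ msq Z <= 2 * msq Y + 2 * msq (fun w => Z w - Y w).
Proof.
move=> Y2 ZY2.
have e : Z = (fun w => Y w + (Z w - Y w)) by apply/funext => w; rewrite addrC subrK.
by split; [rewrite e; exact: L2D|rewrite {1}e; exact: msqD_le].
Qed.

Lemma msq_sym Y Z : msq (fun w => Y w - Z w) = msq (fun w => Z w - Y w).
Proof. by apply: eq_Rintegral => w _; rewrite -sqrrN opprB. Qed.

Lemma expR_le_inv (y : R) : y < 1 -> expR y <= (1 - y)^-1.
Proof.
move=> y1; rewrite -[expR y]invrK -expRN lef_pV2 ?posrE ?subr_gt0 ?expR_gt0//.
exact: expR_ge1Dx.
Qed.

Lemma expRN_le_inv (y : R) : 0 <= y -> expR (- y) <= (1 + y)^-1.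
Proof.
move=> y0; rewrite expRN lef_pV2 ?posrE ?expR_gt0 ?ltr_wpDr//.
exact: expR_ge1Dx.
Qed.

Lemma derive_ge0_le (f f' : R -> R) (x : R) : 0 <= x ->
  (forall y : R, is_derive y 1 f (f' y)) -> (forall y, 0 <= f' y) -> f 0 <= f x.
Proof.
move=> x0 df f'0.
have [] := @MVT_segment _ f f' _ _ x0 (fun y _ => df y).
  apply: continuous_subspaceT => y.
  exact/differentiable_continuous/derivable1_diffP.
by move=> c _ e; rewrite -subr_ge0 e mulr_ge0// subr0.
Qed.

Lemma normr_sin_le (x : R) : `|sin x| <= `|x|.
Proof.
have pos (y : R) : 0 <= y -> sin y <= y.
  move=> y0; rewrite -subr_ge0.
  have := @derive_ge0_le (fun y => y - sin y) (fun y => 1 - cos y) y y0.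
  by rewrite sin0 subr0; apply => z; rewrite subr_ge0 cos_le1.
have pos' (y : R) : 0 <= y -> - sin y <= y.
  move=> y0; rewrite -subr_ge0 opprK.
  have := @derive_ge0_le (fun y => y + sin y) (fun y => 1 + cos y) y y0.
  by rewrite sin0 addr0; apply => z; rewrite -lerBlDl sub0r cos_geN1.
have pos2 (y : R) : 0 <= y -> `|sin y| <= y by move=> y0; rewrite ler_norml lerNl pos// pos'.
have [x0|x0] := leP 0 x; first by rewrite (ger0_norm x0) pos2.
by rewrite (ltr0_norm x0) -normrN -sinN pos2// oppr_ge0 ltW.
Qed.

Lemma cos_ge_sqr (x : R) : 1 - x ^+ 2 / 2 <= cos x.
Proof.
have -> : cos x = 1 - 2 * sin (x / 2) ^+ 2.
  have {1}-> : x = x / 2 + x / 2 by field.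
  by rewrite cosD -!expr2 cos2sin2; ring.
have := normr_sin_le (x / 2).
rewrite -(ler_pXn2r (n := 2))// ?nnegrE// !real_normK ?num_real//.
rewrite expr_div_n; lra.
Qed.

(** The difference [expR x + expR (- x) - 2] is the square of [expR (x / 2) - expR (- (x / 2))], and
    the latter is at least [x] when [x >= 0]. *)
Lemma expRD_ge_sqr (x : R) : 2 + x ^+ 2 <= expR x + expR (- x).
Proof.
have two (y : R) : 2 <= expR y + expR (- y).
  by have := expR_ge1Dx y; have := expR_ge1Dx (- y); lra.
have pos (y : R) : 0 <= y -> 2 * y <= expR y - expR (- y).
  move=> y0; rewrite -subr_ge0.
  have := @derive_ge0_le (fun y => expR y - expR (- y) - 2 * y)
    (fun y => expR y + expR (- y) - 2) y y0.
  rewrite oppr0 mulr0 subrr subr0; apply => z; last by rewrite subr_ge0.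
  apply: is_derive_eq; rewrite /GRing.scale /=; ring.
wlog x0 : x / 0 <= x.
  move=> h; have [/h//|/ltW x0] := leP 0 x.
  by have := h (- x); rewrite oppr_ge0 sqrrN opprK [X in _ -> _ <= X]addrC; apply.
have := pos (x / 2); rewrite divr_ge0// => /(_ isT).
have -> : expR x = expR (x / 2) * expR (x / 2) by rewrite -expRD -splitr.
have -> : expR (- x) = expR (- (x / 2)) * expR (- (x / 2)).
  by rewrite -expRD -opprD -splitr.
have : expR (x / 2) * expR (- (x / 2)) = 1 by rewrite -expRD subrr expR0.
set e := expR _; set e' := expR _ => ee' h.
have x2 : 0 <= x / 2 by rewrite divr_ge0.
have h0 : 0 <= 2 * (x / 2) by rewrite mulr_ge0.
have : (2 * (x / 2)) ^+ 2 <= (e - e') ^+ 2.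
  by rewrite ler_sqr ?nnegrE ?(le_trans h0).
have -> : 2 * (x / 2) = x by field.
rewrite sqrrB ee'; lra.
Qed.

(** Comparing the cosine and the hyperbolic cosine with parabolas, at a single well chosen argument
    each, identifies [v] with the variance up to a factor 2 without differentiating the
    transforms. *)
Lemma centered_gaussian_msq G v : L2 G -> centered_gaussian P G v ->
  v <= 2 * msq G /\ msq G <= 2 * v.
Proof.
move=> G2 [v0 hcos hexp]; have [mG iG] := G2; split.
  have [->|v1] := eqVneq v 0; first by rewrite mulr_ge0// msq_ge0.
  have {v0 v1} v0 : 0 < v by rewrite lt_neqAle eq_sym v1.
  (* With this [a] the mean cosine is [expR (-1)], at most one half. *)
  pose a : R := Num.sqrt (2 / v).
  have a2 : a ^+ 2 = 2 / v by rewrite sqr_sqrtr// divr_ge0// ltW.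
  have h : 1 - a ^+ 2 / 2 * msq G <= \int[P]_w cos (a * G w).
    rewrite /msq -RintegralZl// -[X in X - _](Rintegral_cst_probability P).
    rewrite -RintegralB//.
    + apply: le_Rintegral => //.
      * apply: integrable_EFinB => //; last exact: integrable_EFinZl.
        exact: finite_measure_integrable_cst.
      * exact: integrable_cosM.
      * move=> w _; rewrite (le_trans _ (cos_ge_sqr _))// exprMn.
        by rewrite mulrAC.
    + exact: finite_measure_integrable_cst.
    + exact: integrable_EFinZl.
  rewrite hcos a2 in h.
  have e1 : expR (- (2 / v * v / 2)) <= 2^-1.
    have -> : 2 / v * v / 2 = 1 by field; rewrite gt_eqF.
    by rewrite (le_trans (expRN_le_inv _))//.
  have {h} : 1 - msq G / v <= 2^-1.
    apply: le_trans e1; apply: le_trans h; rewrite le_eqVlt; apply/orP; left.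
    by apply/eqP; field; rewrite gt_eqF.
  rewrite lerBlDl -lerBlDr (_ : 1 - 2^-1 = 2^-1); last by field.
  by rewrite ler_pdivlMr// mulrC ler_pdivrMr// mulrC.
have h l : 2 + l ^+ 2 * msq G <= 2 * expR (l ^+ 2 * v / 2).
  have ie b : P.-integrable setT (EFin \o (fun w => expR (b * G w))).
    apply/integrableP; split.
      by apply/measurable_EFinP; apply: measurableT_comp => //; exact: measurable_funM.
    under eq_integral do rewrite /= ger0_norm ?expR_ge0//.
    by rewrite hexp ltry.
  have E b : \int[P]_w expR (b * G w) = expR (b ^+ 2 * v / 2).
    by rewrite /Rintegral hexp.
  have -> : 2 * expR (l ^+ 2 * v / 2) = \int[P]_w (expR (l * G w) + expR (- l * G w)).
    by rewrite RintegralD// ?E ?sqrrN ?mulr2n ?mulrDl ?mul1r//; exact: ie.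
  rewrite /msq -RintegralZl// -[X in X + _](Rintegral_cst_probability P).
  rewrite -RintegralD//; last 2 first.
  - exact: finite_measure_integrable_cst.
  - exact: integrable_EFinZl.
  apply: le_Rintegral => //.
  - apply: integrable_EFinD => //; last exact: integrable_EFinZl.
    exact: finite_measure_integrable_cst.
  - by apply: integrable_EFinD => //; exact: ie.
  - by move=> w _; rewrite -exprMn mulNr expRD_ge_sqr.
have [vz|v1] := eqVneq v 0.
  have := h 1; rewrite vz expr1n !mul1r mul0r expR0 mulr1 mulr0 gerDl//.
have {v0 v1} v0 : 0 < v by rewrite lt_neqAle eq_sym v1.
(* Here the transform is [expR (1 / 2)], at most 2. *)
have := h (Num.sqrt v^-1).
have -> : Num.sqrt v^-1 ^+ 2 = v^-1 by rewrite sqr_sqrtr// invr_ge0 ltW.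
have -> : v^-1 * v / 2 = 1 / 2 by field; rewrite gt_eqF.
move=> {}h.
have e2 : expR (1 / 2) <= 2 :> R.
  rewrite [leRHS](_ : _ = (1 - 1 / 2)^-1); last by field.
  by apply: expR_le_inv; lra.
have : v^-1 * msq G <= 2 by lra.
by rewrite mulrC ler_pdivrMr.
Qed.

End L2.

(** * Mean-square closure of the combinations of the noise *)

Section wiener_space.
Context d (T : measurableType d) (R : realType) (P : probability T R).
Variable W : set R -> {RV P >-> R}.
Hypothesis W_white : white_noise W.
Implicit Types (Y Z G : T -> R) (eps v : R).

Definition noise_comb G := exists n (a : 'I_n -> R) (A : 'I_n -> set R),
  (forall i, finite_borel (A i)) /\ G = fun w => \sum_(i < n) a i * W (A i) w.

Lemma noise_L2 A : finite_borel A -> L2 P (W A).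
Proof.
move=> fA; apply: L2_fin => //.
have [_ _ /(_ A A fA fA)] := W_white.
rewrite setIid unlock => e.
under eq_integral do rewrite expr2.
by rewrite e; case: fA.
Qed.

Lemma noise_comb_L2 G : noise_comb G -> L2 P G.
Proof.
move=> [n [a [A [fA ->]]]]; apply: L2_sum => i; apply: L2Z.
exact: noise_L2.
Qed.

Lemma noise_combD G1 G2 : noise_comb G1 -> noise_comb G2 ->
  noise_comb (fun w => G1 w + G2 w).
Proof.
move=> [n [a [A [fA ->]]]] [m [b [B [fB ->]]]].
exists (n + m)%N, (fun i => match fintype.split i with inl j => a j | inr k => b k end),
  (fun i => match fintype.split i with inl j => A j | inr k => B k end).
split; first by move=> i; case: (fintype.split i).
apply/funext => w; rewrite big_split_ord /=; congr (_ + _); apply: eq_bigr => i _.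
  by rewrite (unsplitK (inl i)).
by rewrite (unsplitK (inr i)).
Qed.

Lemma noise_combZ (c : R) G : noise_comb G -> noise_comb (fun w => c * G w).
Proof.
move=> [n [a [A [fA ->]]]]; exists n, (fun i => c * a i), A; split => //.
by apply/funext => w; rewrite mulr_sumr; apply: eq_bigr => i _; rewrite mulrA.
Qed.

Lemma noise_comb_centered G : noise_comb G -> exists v, centered_gaussian P G v.
Proof.
move=> Gc; have G2 := noise_comb_L2 Gc.
apply: gaussian_rv_centered; first by case: G2.
  case: Gc => n [a [A [fA ->]]].
  by have [gp _ _] := W_white; exact: gp.
case: Gc => n [a [A [fA GE]]].
have iG := L2_integrable G2.
suff : \int[P]_w G w = 0.
  by rewrite /Rintegral => h; rewrite -[LHS]fineK ?h//; exact: integrable_fin_num.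
rewrite GE Rintegral_sum//; last first.
  by move=> i; apply: integrable_EFinZl => //; exact: L2_integrable (noise_L2 (fA i)).
rewrite big1// => i _; rewrite RintegralZl//; last exact: L2_integrable (noise_L2 (fA i)).
have [_ /(_ (A i) (fA i)) + _] := W_white.
by rewrite unlock /Rintegral => ->; rewrite mulr0.
Qed.

(** The first Wiener chaos, at the level of functions. The [L2] clause matters: [msq] takes the
    default value 0 when the integral is infinite. *)
Definition wiener Z := measurable_fun setT Z /\ forall eps, 0 < eps ->
  exists G, [/\ noise_comb G, L2 P (fun w => Z w - G w) &
                msq P (fun w => Z w - G w) < eps].

Lemma wiener_L2 Z : wiener Z -> L2 P Z.
Proof.
move=> [mZ /(_ 1 ltr01)[G [Gc ZG _]]].
by case: (msq_close (noise_comb_L2 Gc) ZG).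
Qed.

Lemma wienerD Y Z : wiener Y -> wiener Z -> wiener (fun w => Y w + Z w).
Proof.
move=> [mY hY] [mZ hZ]; split; first exact: measurable_funD.
move=> eps e0.
have [|G1 [c1 l1 m1]] := hY (eps / 4); first by rewrite divr_gt0.
have [|G2 [c2 l2 m2]] := hZ (eps / 4); first by rewrite divr_gt0.
exists (fun w => G1 w + G2 w).
have e : (fun w => Y w + Z w - (G1 w + G2 w)) = (fun w => (Y w - G1 w) + (Z w - G2 w)).
  by apply/funext => w; ring.
rewrite e; split; first exact: noise_combD.
  exact: L2D.
by rewrite (le_lt_trans (msqD_le l1 l2))//; lra.
Qed.

Lemma wienerZ (c : R) Z : wiener Z -> wiener (fun w => c * Z w).
Proof.
move=> [mZ hZ]; split; first exact: measurable_funM.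
move=> eps e0.
have c0 : 0 < c ^+ 2 + 1 by rewrite ltr_wpDl// sqr_ge0.
have [|G [c1 l1 m1]] := hZ (eps / (c ^+ 2 + 1)); first by rewrite divr_gt0.
exists (fun w => c * G w).
have e : (fun w => c * Z w - c * G w) = (fun w => c * (Z w - G w)).
  by apply/funext => w; ring.
rewrite e; split; first exact: noise_combZ.
  exact: L2Z.
rewrite msqZ// (@le_lt_trans _ _ ((c ^+ 2 + 1) * msq P (fun w => Z w - G w)))//.
  by rewrite ler_wpM2r ?msq_ge0// lerDl.
by rewrite mulrC -ltr_pdivlMr.
Qed.

Lemma wienerB Y Z : wiener Y -> wiener Z -> wiener (fun w => Y w - Z w).
Proof.
move=> wY wZ; rewrite (_ : (fun w => _) = fun w => Y w + (-1) * Z w).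
  by apply: wienerD => //; exact: wienerZ.
by apply/funext => w; rewrite mulN1r.
Qed.

Lemma wiener0 : wiener (fun=> 0).
Proof.
split; first exact: measurable_cst.
move=> eps e0; exists (fun=> 0).
have e : (fun w : T => 0 - 0 : R) = fun=> 0 by apply/funext => w; rewrite subrr.
rewrite e; split.
- exists 0%N, (fun=> 0), (fun=> set0); split; first by case.
  by apply/funext => w; rewrite big_ord0.
- exact: L2_cst.
- rewrite /msq; under eq_Rintegral do rewrite expr0n/=.
  by rewrite (Rintegral_cst_probability P 0).
Qed.

Lemma wiener_sum n (Y : 'I_n -> T -> R) : (forall i, wiener (Y i)) ->
  wiener (fun w => \sum_(i < n) Y i w).
Proof.
elim: n Y => [|n IH] Y hY.
  rewrite (_ : (fun w => _) = fun=> 0); first exact: wiener0.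
  by apply/funext => w; rewrite big_ord0.
rewrite (_ : (fun w => _) = fun w => \sum_(i < n) Y (widen_ord (leqnSn n) i) w + Y ord_max w).
  by apply: wienerD => //; exact: IH.
by apply/funext => w; rewrite big_ord_recr.
Qed.

Lemma mBm_wiener (H : R -> R) (X : R -> {RV P >-> R}) t : mBm W H X -> 0 <= t ->
  wiener (X t).
Proof.
move=> hX t0; split; first exact: measurable_funP.
move=> eps e0; have [n [a [A [fA _ XA]]]] := hX t t0 eps e0.
pose G w := \sum_(i < n) a i * W (A i) w.
have Gc : noise_comb G by exists n, a, A.
have [mG _] := noise_comb_L2 Gc.
rewrite unlock in XA.
have L2D : L2 P (fun w => X t w - G w).
  apply: L2_fin; first by apply: measurable_funB => //; exact: measurable_funP.
  by rewrite (lt_trans XA)// ltry.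
exists G; split => //.
by rewrite -lte_fin -msqE.
Qed.

Lemma sqr_norm_le (x delta : R) : 0 < delta -> `|x| <= delta / 2 + x ^+ 2 / (2 * delta).
Proof.
move=> d0; rewrite -[x ^+ 2]real_normK ?num_real//.
have := sqr_ge0 (`|x| - delta); set y := `|x| => h.
have -> : delta / 2 + y ^+ 2 / (2 * delta) = y + (y - delta) ^+ 2 / (2 * delta).
  by field; rewrite gt_eqF.
by rewrite lerDl divr_ge0// mulr_ge0// ltW.
Qed.

Lemma normr_cosB_le (x y : R) : `|cos x - cos y| <= `|x - y|.
Proof.
have -> : cos x - cos y = - 2 * sin ((x + y) / 2) * sin ((x - y) / 2).
  have e1 : cos x = cos ((x + y) / 2 + (x - y) / 2) by congr cos; field.
  have e2 : cos y = cos ((x + y) / 2 - (x - y) / 2) by congr cos; field.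
  by rewrite e1 e2 cosD cosB; ring.
rewrite !normrM normrN.
have h1 := sin_max ((x + y) / 2); have h2 := normr_sin_le ((x - y) / 2).
have -> : `|x - y| = 2 * `|(x - y) / 2|.
  by rewrite normrM [X in _ * (_ * X)]ger0_norm ?invr_ge0//; field.
rewrite [X in X * _ * _]ger0_norm// -mulrA ler_wpM2l//.
by rewrite (le_trans (ler_wpM2r _ h1))// mul1r.
Qed.

(** The cosine is 1-Lipschitz, so the bound for a close combination [G] survives. The 8 comes from
    [msq P G <= 2 * v] and from [msq P Z <= 2 * msq P G] up to a small error. *)
Lemma wiener_cos Z : wiener Z -> \int[P]_w cos (Z w) <= expR (- (msq P Z / 8)).
Proof.
move=> wZ; have Z2 := wiener_L2 wZ; have [mZ hZ] := wZ.
apply/ler_addgt0Pr => e e0.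
pose delta := Num.min (e / 4) 1.
have d0 : 0 < delta by rewrite lt_min ltr01 divr_gt0.
have d1 : delta <= 1 by rewrite ge_min lexx orbT.
have de : delta <= e / 4 by rewrite ge_min lexx.
have [|G [Gc ZG mZG]] := hZ (delta ^+ 2); first by rewrite exprn_gt0.
have G2 := noise_comb_L2 Gc; have [mG _] := G2.
have [v [v0 hcos hexp]] := noise_comb_centered Gc.
have [vle mle] := centered_gaussian_msq G2 (And3 v0 hcos hexp).
have step : \int[P]_w cos (Z w) <= \int[P]_w cos (G w) + delta.
  have i0 := integrable_cos P mZ; have i1 := integrable_cos P mG; have [_ i2] := ZG.
  have ic (c : R) : P.-integrable setT (EFin \o (fun=> c)) by exact: finite_measure_integrable_cst.
  have i3 := integrable_EFinZl (2 * delta)^-1 measurableT i2.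
  have i4 := integrable_EFinD measurableT (ic (delta / 2)) i3.
  have : \int[P]_w cos (Z w) <=
      \int[P]_w (cos (G w) + (delta / 2 + (2 * delta)^-1 * (Z w - G w) ^+ 2)).
    apply: le_Rintegral => //; first exact: integrable_EFinD.
    move=> w _; rewrite -lerBlDl (le_trans (ler_norm _))//.
    rewrite (le_trans (normr_cosB_le _ _))// [_^-1 * _]mulrC.
    exact: sqr_norm_le.
  rewrite RintegralD// RintegralD// (Rintegral_cst_probability P) RintegralZl//.
  move=> h; apply: (le_trans h); rewrite lerD2l.
  have : (2 * delta)^-1 * msq P (fun w => Z w - G w) <= (2 * delta)^-1 * delta ^+ 2.
    by rewrite ler_wpM2l ?invr_ge0 ?mulr_ge0 ?ltW.
  have -> : (2 * delta)^-1 * delta ^+ 2 = delta / 2 by field; rewrite gt_eqF.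
  by move=> hh; rewrite [leRHS]splitr lerD2l.
have cG : \int[P]_w cos (G w) = expR (- (v / 2)).
  by have := hcos 1; rewrite expr1n mul1r => <-; apply: eq_Rintegral => w _; rewrite mul1r.
have mZle : msq P Z <= 2 * msq P G + 2 * delta ^+ 2.
  have [_ h] := msq_close G2 ZG; rewrite (le_trans h)// lerD2l ler_pM2l//.
  exact: ltW.
have e1 : expR (- (v / 2)) <= expR (- (msq P Z / 8)) * expR (delta ^+ 2 / 4).
  by rewrite -expRD ler_expR; lra.
have d2 : delta ^+ 2 <= delta by rewrite expr2 ler_piMl// ltW.
have e2 : expR (delta ^+ 2 / 4) <= 1 + delta.
  rewrite (le_trans (expR_le_inv _))//; first by lra.
  rewrite -[leLHS]mul1r ler_pdivrMr; last by lra.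
  by nra.
have e3 : expR (- (msq P Z / 8)) <= 1.
  by rewrite expR_le1 oppr_le0 divr_ge0// msq_ge0.
have e4 := expR_ge0 (- (msq P Z / 8)).
rewrite cG in step; move: e1 e2 e3 e4 step.
by set E := expR (- (msq P Z / 8)); set F := expR (_ / 4); nra.
Qed.

End wiener_space.

(** * Tails and small balls *)

Section probability_bounds.
Context d (T : measurableType d) (R : realType) (P : probability T R).
Variable W : set R -> {RV P >-> R}.
Hypothesis W_white : white_noise W.
Implicit Types (Y Z G : T -> R) (v x : R).

Lemma measurable_ge_cst Y x : measurable_fun setT Y -> measurable [set w | x <= Y w].
Proof.
move=> mY; rewrite (_ : [set w | _] = setT `&` Y @^-1` `[x, +oo[%classic).
  exact: mY.
by apply/seteqP; split => w /=; rewrite in_itv/= andbT; [split|case].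
Qed.

Lemma measurable_le_cst Y x : measurable_fun setT Y -> measurable [set w | Y w <= x].
Proof.
move=> mY; rewrite (_ : [set w | _] = setT `&` Y @^-1` `]-oo, x]%classic).
  exact: mY.
by apply/seteqP; split => w /=; rewrite in_itv/=; [split|case].
Qed.

Lemma measurable_norm Y : measurable_fun setT Y -> measurable_fun setT (fun w => `|Y w|).
Proof. by move=> mY; exact: measurableT_comp. Qed.

(** Chernoff's bound for both signs; [l = x / u] minimises [l ^+ 2 * u / 2 - l * x]. The bound [u]
    replaces [v], which may be 0. *)
Lemma centered_gaussian_tail G v u x : measurable_fun setT G ->
  centered_gaussian P G v -> v <= u -> 0 < u -> 0 < x ->
  (P [set w | (x <= `|G w|)%R] <= (2 * expR (- (x ^+ 2 / (2 * u))))%:E)%E.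
Proof.
move=> mG [v0 _ hexp] vu u0 x0.
pose l := x / u.
have l0 : 0 < l by rewrite divr_gt0.
have ie b : P.-integrable setT (EFin \o (fun w => expR (b * G w))).
  apply/integrableP; split.
    by apply/measurable_EFinP; apply: measurableT_comp => //; exact: measurable_funM.
  under eq_integral do rewrite /= ger0_norm ?expR_ge0//.
  by rewrite hexp ltry.
have E b : \int[P]_w expR (b * G w) = expR (b ^+ 2 * v / 2).
  by rewrite /Rintegral hexp.
apply: (le_trans (@measure_le_Rintegral _ _ _ P _
   (fun w => expR (l * G w) + expR (- l * G w)) (expR (l * x)) _ _ _ _ _)).
- exact/measurable_ge_cst/measurable_norm.
- by apply: integrable_EFinD => //; exact: ie.
- by move=> w; rewrite addr_ge0 ?expR_ge0.
- move=> w /= xG; have [G0|G0] := leP 0 (G w).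
    rewrite ger0_norm// in xG; rewrite ler_wpDr ?expR_ge0// ler_expR ler_pM2l//.
  rewrite ltr0_norm// in xG; rewrite ler_wpDl ?expR_ge0// ler_expR mulNr -mulrN ler_pM2l//.
- exact: expR_gt0.
rewrite lee_fin RintegralD// !E sqrrN.
have -> (a b : R) : (a + a) / b = 2 * (a / b) by ring.
rewrite ler_pM2l// -expRB ler_expR.
have -> : - (x ^+ 2 / (2 * u)) = l ^+ 2 * u / 2 - l * x.
  by rewrite /l; field; rewrite gt_eqF.
by rewrite lerD2r ler_pM2r// ler_pM2l// exprn_gt0.
Qed.

(** The threshold is halved between a close combination [G], of parameter at most [8 * v], and
    [Z - G], which Chebyshev's inequality handles; [64] is [4 * (2 * 8)]. *)
Lemma wiener_tail Z v x : wiener W Z -> msq P Z <= v -> 0 < v -> 0 < x ->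
  (P [set w | (x <= `|Z w|)%R] <= (2 * expR (- (x ^+ 2 / (64 * v))))%:E)%E.
Proof.
move=> wZ Zv v0 x0; have Z2 := wiener_L2 W_white wZ; have [mZ hZ] := wZ.
apply/lee_addgt0Pr => e e0.
(* The first bound yields [vG <= 8 * v], the second makes the Chebyshev term at most [e]. *)
pose eps := Num.min v (e * x ^+ 2 / 4).
have eps0 : 0 < eps by rewrite lt_min v0 divr_gt0// mulr_gt0// exprn_gt0.
have [G [Gc ZG mZG]] := hZ eps eps0.
have G2 := noise_comb_L2 W_white Gc; have [mG _] := G2.
have [vG cg] := noise_comb_centered W_white Gc.
have [vle mle] := centered_gaussian_msq G2 cg.
have vG8 : vG <= 8 * v.
  have GZ : L2 P (fun w => G w - Z w).
    rewrite (_ : (fun w => _) = fun w => (-1) * (Z w - G w)); first exact: L2Z.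
    by apply/funext => w; rewrite mulN1r opprB.
  have [_ h] := msq_close Z2 GZ; rewrite msq_sym in h.
  have : eps <= v by rewrite ge_min lexx.
  by lra.
have sub : [set w | x <= `|Z w|] `<=`
    [set w | x / 2 <= `|G w|] `|` [set w | x / 2 <= `|Z w - G w|].
  move=> w /= xZ; have [h|h] := leP (x / 2) `|G w|; [by left|right].
  have := ler_normD (G w) (Z w - G w); rewrite addrC subrK; lra.
have mZGf : measurable_fun setT (fun w => Z w - G w) by exact: measurable_funB.
have m1 : measurable [set w | x / 2 <= `|G w|] by exact/measurable_ge_cst/measurable_norm.
have m2 : measurable [set w | x / 2 <= `|Z w - G w|] by exact/measurable_ge_cst/measurable_norm.
apply: (@le_trans _ _ (P [set w | (x / 2 <= `|G w|)%R] + P [set w | (x / 2 <= `|Z w - G w|)%R])%E).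
  apply: le_trans (measureU2 P m1 m2).
  apply: le_measure => //; rewrite inE; last exact: measurableU.
  exact/measurable_ge_cst/measurable_norm.
apply: leeD.
  apply: (le_trans (centered_gaussian_tail mG cg vG8 _ _)); rewrite ?mulr_gt0 ?invr_gt0//.
  rewrite lee_fin le_eqVlt; apply/orP; left; apply/eqP; congr (_ * expR (- _)).
  by field; rewrite gt_eqF.
apply: (le_trans (@measure_le_Rintegral _ _ _ P _
   (fun w => (Z w - G w) ^+ 2) ((x / 2) ^+ 2) _ _ _ _ _)) => //.
- by case: ZG.
- by move=> w; exact: sqr_ge0.
- move=> w /= h; rewrite -[leRHS]real_normK ?num_real// ler_sqr ?nnegrE ?divr_ge0// ltW//.
- by rewrite exprn_gt0// divr_gt0.
rewrite lee_fin -/(msq P _) ler_pdivrMr ?exprn_gt0 ?divr_gt0// ltW//.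
rewrite (lt_le_trans mZG)//.
have : eps <= e * x ^+ 2 / 4 by rewrite ge_min lexx orbT.
by rewrite expr_div_n -[2 ^+ 2]/(2 * 2); lra.
Qed.

Lemma expRN_le_pow (N : nat) : exists2 K : R, 0 < K &
  forall y : R, 0 < y -> expR (- y) <= K * y^-1 ^+ N.
Proof.
case: N => [|N].
  by exists 1 => // y y0; rewrite expr0 mulr1 expR_le1 oppr_le0 ltW.
exists (N.+1)`!%:R; first by rewrite ltr0n fact_gt0.
move=> y y0; rewrite expRN exprVn -[leRHS]invrK lef_pV2 ?posrE ?expR_gt0//; last first.
  by rewrite invr_gt0 mulr_gt0 ?ltr0n ?fact_gt0// invr_gt0 exprn_gt0.
rewrite invfM invrK mulrC (le_trans _ (expR_ge1Dxn N (ltW y0)))//.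
by rewrite lerDr.
Qed.

(** The polynomial form of the tail is what a moment of order [2 * N] would give; for powers of one
    half it is a mere comparison of exponents. *)
Lemma wiener_tail_pow (N : nat) : exists2 K : R, 0 < K &
  forall Z v x, wiener W Z -> msq P Z <= v -> 0 < v -> 0 < x ->
  (P [set w | (x <= `|Z w|)%R] <= (K * (v / x ^+ 2) ^+ N)%:E)%E.
Proof.
have [K K0 hK] := expRN_le_pow N.
exists (2 * K * 64 ^+ N); first by rewrite !mulr_gt0// exprn_gt0.
move=> Z v x wZ Zv v0 x0; rewrite (le_trans (wiener_tail wZ Zv v0 x0))// lee_fin.
rewrite (_ : 2 * K * 64 ^+ N * _ = 2 * (K * (64 * (v / x ^+ 2)) ^+ N)); last first.
  by rewrite [in RHS]exprMn; move: (_ ^+ N) (_ ^+ N) => p q; ring.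
rewrite ler_pM2l// (le_trans (hK _ _))//.
  by rewrite divr_gt0 ?exprn_gt0 ?mulr_gt0.
rewrite le_eqVlt; apply/orP; left; apply/eqP; congr (_ * _ ^+ N).
by field; rewrite !gt_eqF.
Qed.

(** With truncated subtraction the exponent is the distance between [a] and [b], so the sum consists
    of two geometric series. *)
Lemma sum_geo_dist (a M : nat) :
  \sum_(b < M) 2^-1 ^+ ((a - b) + (b - a))%N <= 4 :> R.
Proof.
have h1 k : (k <= a.+1)%N ->
    \sum_(b < k) 2^-1 ^+ ((a - b) + (b - a))%N <= 2 * 2^-1 ^+ (a.+1 - k) :> R.
  elim: k => [|k IH] ka; first by rewrite big_ord0 mulr_ge0// exprn_ge0// invr_ge0.
  rewrite big_ord_recr/= (eqP (ka : k - a == 0)%N) addn0 subSS.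
  have := IH (ltnW ka); rewrite subSn// exprS mulrA divff// mul1r.
  by move: (_ ^+ _) => e; lra.
have h2 k : \sum_(b < (a.+1 + k)%N) 2^-1 ^+ ((a - b) + (b - a))%N <= 4 - 2 * 2^-1 ^+ k :> R.
  elim: k => [|k IH].
    by rewrite addn0 (le_trans (h1 _ _))// subnn expr0; lra.
  rewrite addnS big_ord_recr/=.
  have -> : (a - (a.+1 + k) + (a.+1 + k - a) = k.+1)%N.
    by rewrite (eqP (_ : a - (a.+1 + k) == 0)%N) ?subn_eq0; lia.
  move: IH; rewrite exprS; move: (\sum_(_ < _) _) => S.
  have : 0 <= 2^-1 ^+ k :> R by rewrite exprn_ge0// invr_ge0.
  by move: (_ ^+ k) => e; lra.
have [Ma|Ma] := leqP M a.+1.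
  rewrite (le_trans (h1 _ Ma))//.
  have : 2^-1 ^+ (a.+1 - M) <= 1 :> R by rewrite exprn_ile1// ?invr_ge0// invf_le1// ler1n.
  by move: (_ ^+ _) => e; lra.
rewrite -(subnKC (ltnW Ma)) (le_trans (h2 _))//.
have : 0 <= 2^-1 ^+ (M - a.+1) :> R by rewrite exprn_ge0// invr_ge0.
by move: (_ ^+ _) => e; lra.
Qed.

(** For fixed [m] the sum over [m'] factors into one-dimensional sums, each at most 4. *)
Lemma sum_prod_geo_dist (n M : nat) :
  \sum_(m : {ffun 'I_n -> 'I_M}) \sum_(m' : {ffun 'I_n -> 'I_M})
    \prod_i 2^-1 ^+ ((m i - m' i) + (m' i - m i))%N <= (M%:R * 4) ^+ n :> R.
Proof.
apply: (@le_trans _ _ (\sum_(m : {ffun 'I_n -> 'I_M}) 4 ^+ n)).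
  apply: ler_sum => m _.
  rewrite -(bigA_distr_bigA (fun i (b : 'I_M) => 2^-1 ^+ ((m i - b) + (b - m i))%N : R)).
  rewrite -[X in 4 ^+ X]card_ord -prodr_const; apply: ler_prod => i _.
  by rewrite sum_geo_dist sumr_ge0// => b _; rewrite exprn_ge0// invr_ge0.
by rewrite sumr_const card_ffun !card_ord exprMn -(natrX _ M) mulr_natl.
Qed.

End probability_bounds.

(** * Small-ball probabilities from mean cosines *)

Section small_ball.
Context d (T : measurableType d) (R : realType) (P : probability T R).
Variable W : set R -> {RV P >-> R}.
Hypothesis W_white : white_noise W.
Implicit Types (Y Z G : T -> R) (v x : R).

Lemma measurable_all_small n (D : 'I_n -> T -> R) delta :
  (forall i, measurable_fun setT (D i)) ->
  measurable [set w | forall i, `|D i w| <= delta].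
Proof.
move=> mD; rewrite (_ : [set w | _] = \bigcap_(i in [set: 'I_n]) [set w | `|D i w| <= delta]).
  apply: fin_bigcap_measurable => // i _.
  exact/measurable_le_cst/measurable_norm.
by apply/seteqP; split => w /= h i; [move=> _; exact: h|exact: h].
Qed.

(* The Fejer-type weight [|sum_m e^(i m.D)|^2] is large where all [D i] are small
   and has small mean. *)
Lemma small_ball n (M : nat) (D : 'I_n -> T -> R) (eta : R) : (0 < M)%N ->
  (forall i, wiener W (D i)) ->
  (forall x : 'I_n -> R, 8 * \sum_i x i ^+ 2 <= msq P (fun w => \sum_i x i * D i w)) ->
  n%:R * M%:R * eta <= 1 ->
  (P [set w | forall i, (`|D i w| <= eta)%R] <= (4 * (4 / M%:R) ^+ n)%:E)%E.
Proof.
move=> M0 wD hD nMeta.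
pose th (m : {ffun 'I_n -> 'I_M}) w := \sum_i (m i)%:R * D i w.
pose A w := \sum_(m : {ffun 'I_n -> 'I_M}) cos (th m w).
pose B w := \sum_(m : {ffun 'I_n -> 'I_M}) sin (th m w).
(* The squared modulus of the exponential sum expands into cosines of differences of phases, to
   which [wiener_cos] applies. *)
have ABE w : A w ^+ 2 + B w ^+ 2 =
    \sum_(m : {ffun 'I_n -> 'I_M}) \sum_(m' : {ffun 'I_n -> 'I_M})
      cos (\sum_i ((m i)%:R - (m' i)%:R) * D i w).
  rewrite !expr2 /A /B !mulr_suml -big_split/=; apply: eq_bigr => m _.
  rewrite !mulr_sumr -big_split/=; apply: eq_bigr => m' _.
  rewrite -cosB; congr cos; rewrite /th -sumrB; apply: eq_bigr => i _.
  by rewrite mulrBl.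
have wS (x : 'I_n -> R) : wiener W (fun w => \sum_i x i * D i w).
  by apply: wiener_sum => i; exact: wienerZ.
have ic Z : wiener W Z -> P.-integrable setT (EFin \o (fun w => cos (Z w))).
  by move=> [mZ _]; exact: integrable_cos.
have i1 m : P.-integrable setT (EFin \o (fun w => \sum_(m' : {ffun 'I_n -> 'I_M})
      cos (\sum_i ((m i)%:R - (m' i)%:R) * D i w))).
  by apply: integrable_EFin_sum => // m'; apply: ic.
have Mn : 0 < M%:R ^+ n :> R by rewrite exprn_gt0// ltr0n.
apply: (le_trans (@measure_le_Rintegral _ _ _ P _
   (fun w => A w ^+ 2 + B w ^+ 2) ((M%:R ^+ n / 2) ^+ 2) _ _ _ _ _)).
- by apply: measurable_all_small => i; case: (wD i).
- apply: (eq_integrable measurableT (EFin \o (fun w =>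
    \sum_(m : {ffun 'I_n -> 'I_M}) \sum_(m' : {ffun 'I_n -> 'I_M})
      cos (\sum_i ((m i)%:R - (m' i)%:R) * D i w)))).
    by move=> w _; rewrite /= ABE.
  exact: integrable_EFin_sum.
- by move=> w; rewrite addr_ge0// sqr_ge0.
- move=> w /= hw.
  (* On the event every phase is at most [n * M * eta <= 1] in absolute value, so each cosine is at
     least one half. *)
  have hA : M%:R ^+ n / 2 <= A w.
    have ->: M%:R ^+ n / 2 = \sum_(m : {ffun 'I_n -> 'I_M}) (2^-1 : R).
      by rewrite sumr_const card_ffun !card_ord -(natrX _ M) mulr_natl.
    apply: ler_sum => m _; rewrite (le_trans _ (cos_ge_sqr _))//.
    have : `|th m w| <= 1.
      apply: le_trans nMeta; rewrite (le_trans (ler_norm_sum _ _ _))//.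
      have -> : n%:R * M%:R * eta = \sum_(i < n) M%:R * eta.
        by rewrite sumr_const card_ord -mulrA mulr_natl.
      apply: ler_sum => i _; rewrite normrM normr_nat ler_pM//.
      by rewrite ler_nat ltnW.
    rewrite -(ler_pXn2r (n := 2))// ?nnegrE// real_normK ?num_real// expr1n; lra.
  have hM : 0 <= M%:R ^+ n / 2 :> R by rewrite divr_ge0// ltW.
  by rewrite ler_wpDr ?sqr_ge0// ler_sqr ?nnegrE// (le_trans hM).
- by rewrite exprn_gt0// divr_gt0.
rewrite lee_fin ler_pdivrMr; last by rewrite exprn_gt0// divr_gt0.
have -> : 4 * (4 / M%:R) ^+ n * (M%:R ^+ n / 2) ^+ 2 = (M%:R * 4) ^+ n :> R.
  rewrite !exprMn exprVn; move: Mn; move: (_ ^+ n) => a; move: (_ ^+ n) => b a0.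
  by field; rewrite gt_eqF.
apply: le_trans (sum_prod_geo_dist R n M).
under eq_Rintegral do rewrite ABE.
rewrite Rintegral_sum//; apply: ler_sum => m _.
rewrite Rintegral_sum//; last by move=> m'; exact: ic.
apply: ler_sum => m' _.
apply: (le_trans (wiener_cos W_white (wS _))).
(* The factor 8 assumed of the quadratic form cancels the 8 of [wiener_cos]. *)
apply: (@le_trans _ _ (expR (- \sum_i ((m i)%:R - (m' i)%:R) ^+ 2))).
  by rewrite ler_expR lerN2 ler_pdivlMr// mulrC.
rewrite -sumrN expR_sum; apply: ler_prod => i _; rewrite expR_ge0/=.
set k := ((m i - m' i) + (m' i - m i))%N.
have -> : ((m i)%:R - (m' i)%:R) ^+ 2 = k%:R ^+ 2 :> R.
  rewrite /k; have [h|/ltnW h] := leqP (m i) (m' i).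
    by rewrite (eqP (h : m i - m' i == 0)%N) add0n natrB// -sqrrN opprB.
  by rewrite (eqP (h : m' i - m i == 0)%N) addn0 natrB.
have e2 : expR (-1) <= 2^-1 :> R.
  by rewrite expRN lef_pV2 ?posrE ?expR_gt0//; have := expR_ge1Dx (1 : R); lra.
(* For a natural number [k], [k <= k ^+ 2]: the Gaussian weight is below a geometric one. *)
apply: (@le_trans _ _ (expR (-1) ^+ k)).
  rewrite -expRM_natl ler_expR mulrN1 lerN2 -natrX ler_nat.
  by case: (k) => // k'; rewrite expnS expn1 leq_pmulr.
by apply: lerXn2r; rewrite ?nnegrE ?expR_ge0 ?invr_ge0.
Qed.

(** Rescaling by [3 / u] makes the quadratic form at least 9, hence 8, times the sum of squares; [M]
    is then about the inverse of [n.+1 * eta], which keeps the phases below 1. Taking [n.+1] also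
    covers [n = 0]. *)
Lemma small_ball_pow n : exists2 K : R, 0 < K &
  forall (D : 'I_n -> T -> R) (delta u : R), 0 < delta -> 0 < u ->
  (forall i, wiener W (D i)) ->
  (forall x : 'I_n -> R, u ^+ 2 * \sum_i x i ^+ 2 <= msq P (fun w => \sum_i x i * D i w)) ->
  (P [set w | forall i, (`|D i w| <= delta)%R] <= (K * (delta / u) ^+ n)%:E)%E.
Proof.
pose c : R := n.+1%:R * 3.
have c0 : 0 < c by rewrite mulr_gt0.
exists (4 * (8 * c) ^+ n); first by rewrite mulr_gt0// exprn_gt0// mulr_gt0.
move=> D delta u d0 u0 wD hD.
pose eta := 3 * (delta / u).
have du : 0 < delta / u by rewrite divr_gt0.
have eta0 : 0 < eta by rewrite mulr_gt0.
have mS : measurable [set w | forall i, `|D i w| <= delta].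
  by apply: measurable_all_small => i; case: (wD i).
rewrite -mulrA -exprMn.
(* In the first case no positive [M] is available, but the claimed bound exceeds 1. *)
have [big|small] := leP 1 (n.+1%:R * eta).
  apply: (le_trans (probability_le1 P mS)); rewrite lee_fin.
  have : 1 <= (8 * c * (delta / u)) ^+ n.
    rewrite exprn_ege1//.
    have -> : 8 * c * (delta / u) = 8 * (n.+1%:R * eta) by rewrite /c /eta; ring.
    by lra.
  by lra.
pose y := (n.+1%:R * eta)^-1.
have ny0 : 0 < n.+1%:R * eta by rewrite mulr_gt0.
have y1 : 1 < y by rewrite /y invf_gt1.
pose M := Num.truncn y.
have /andP[My yM] : M%:R <= y < M.+1%:R by apply: truncn_itv; rewrite ltW// (lt_trans _ y1).
have M0 : (0 < M)%N by rewrite truncn_gt0 ltW.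
have Mr0 : 0 < M%:R :> R by rewrite ltr0n.
have y2M : y <= 2 * M%:R.
  have : 1 <= M%:R :> R by rewrite ler1n.
  by move: yM; rewrite -natr1; lra.
pose D' i w := 3 / u * D i w.
have := @small_ball n M D' eta M0.
have -> : [set w | forall i, `|D' i w| <= eta] = [set w | forall i, `|D i w| <= delta].
  have u3 : 0 < 3 / u by rewrite divr_gt0.
  have e i w : (`|D' i w| <= eta) = (`|D i w| <= delta).
    have -> : eta = 3 / u * delta by rewrite /eta; ring.
    by rewrite /D' normrM (ger0_norm (ltW u3)) ler_pM2l.
  by apply/seteqP; split => w /= h i; have := h i; rewrite e.
move=> h; apply: (le_trans (h _ _ _)).
- by move=> i; exact: wienerZ.
- move=> x; have -> : (fun w => \sum_i x i * D' i w) = (fun w => 3 / u * \sum_i x i * D i w).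
    by apply/funext => w; rewrite mulr_sumr; apply: eq_bigr => i _; rewrite /D'; ring.
  rewrite msqZ; last by apply: (wiener_L2 W_white); apply: wiener_sum => i; exact: wienerZ.
  apply: (@le_trans _ _ ((3 / u) ^+ 2 * (u ^+ 2 * \sum_i x i ^+ 2))); last first.
    by rewrite ler_wpM2l// sqr_ge0.
  have -> : (3 / u) ^+ 2 * (u ^+ 2 * \sum_i x i ^+ 2) = 9 * \sum_i x i ^+ 2.
    by field; rewrite gt_eqF.
  by rewrite ler_wpM2r ?sumr_ge0// => [i _|]; [exact: sqr_ge0|lra].
- apply: (@le_trans _ _ (n.+1%:R * y * eta)).
    rewrite ler_pM2r// ler_pM// ?ler_nat//.
  by rewrite /y mulrAC mulfV// gt_eqF.
rewrite lee_fin ler_pM2l//; apply: lerXn2r.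
- by rewrite nnegrE divr_ge0.
- by rewrite nnegrE mulr_ge0 ?(ltW du)// mulr_ge0 ?(ltW c0).
rewrite ler_pdivrMr//.
have -> : 8 * c * (delta / u) * M%:R = 4 * (n.+1%:R * eta) * (2 * M%:R) by rewrite /c /eta; ring.
rewrite -mulrA ler_pMr//.
have {1}<- : n.+1%:R * eta * y = 1 by rewrite mulfV// gt_eqF.
by rewrite ler_pM2l.
Qed.

End small_ball.

(** * Dyadic discretization *)

Section dyadic_borel_cantelli.
Context d (T : measurableType d) (R : realType) (P : probability T R).

(** The rate [4^-1 ^+ j] beats the [N * 2 ^ j] events of level [j] and leaves the summable
    [2^-1 ^+ j]. *)
Lemma dyadic_borel_cantelli (E : nat -> nat -> set T) (N j0 : nat) (C : R) :
  0 <= C -> (forall j k, measurable (E j k)) ->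
  (forall j k, (j0 <= j)%N -> (k < N * 2 ^ j)%N -> (P (E j k) <= (C * 4^-1 ^+ j)%:E)%E) ->
  {ae P, forall w, exists J, forall j, (J <= j)%N ->
    forall k, (k < N * 2 ^ j)%N -> ~ E j k w}.
Proof.
move=> C0 mE hE.
pose F j := if (j0 <= j)%N then \big[setU/set0]_(k < N * 2 ^ j) E j k else set0.
have mF j : measurable (F j).
  by rewrite /F; case: ifP => // _; exact: bigsetU_measurable.
have PF j : (P (F j) <= (N%:R * C * 2^-1 ^+ j)%:E)%E.
  rewrite /F; case: ifPn => [jj|_]; last first.
    by rewrite measure0 lee_fin !mulr_ge0// exprn_ge0// invr_ge0.
  have mU : measurable (\big[setU/set0]_(k < N * 2 ^ j) E j k).
    exact: bigsetU_measurable.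
  have sub := @content_subadditive _ _ _ P _ (E j) (N * 2 ^ j)%N (fun k _ => mE j k) mU
    (@subset_refl _ _).
  apply: (le_trans sub).
  apply: (@le_trans _ _ (\sum_(k < N * 2 ^ j) (C * 4^-1 ^+ j)%:E)%E).
    by apply: lee_sum => k _; exact: hE.
  rewrite sumEFin lee_fin sumr_const card_ord -[X in X <= _]mulr_natl natrM natrX -!mulrA.
  rewrite ler_wpM2l// mulrCA ler_wpM2l// -exprMn.
  by rewrite (_ : 2 * 4^-1 = 2^-1 :> R)//; field.
have Foo : (\sum_(0 <= n <oo) P (F n) < +oo)%E.
  apply: (@le_lt_trans _ _ ((N%:R * C * 2)%:E)); last exact: ltry.
  apply: lime_le; first by apply: is_cvg_nneseries.
  apply: nearW => n.
  apply: (@le_trans _ _ (\sum_(0 <= i < n) (N%:R * C * 2^-1 ^+ i)%:E)%E).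
    by apply: lee_sum => k _; exact: PF.
  rewrite sumEFin lee_fin -mulr_sumr ler_wpM2l ?mulr_ge0//.
  have : \sum_(0 <= i < n) 2^-1 ^+ i <= 2 - 2 * 2^-1 ^+ n :> R.
    elim: n => [|n IH]; first by rewrite big_nil expr0; lra.
    by rewrite big_nat_recr//= exprS; lra.
  have : 0 <= 2^-1 ^+ n :> R by rewrite exprn_ge0// invr_ge0.
  lra.
exists (lim_sup_set F); split.
- by apply: bigcapT_measurable => n; apply: bigcup_measurable => m _; exact: mF.
- exact: lim_sup_set_cvg0.
- move=> w /= hw n _; apply: contrapT => hn; apply: hw.
  exists (maxn n j0) => j; rewrite geq_max => /andP[nj jj] k kN Ew; apply: hn.
  exists j => //=; rewrite /F jj -bigcup_mkord; exists k => //.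
Qed.

End dyadic_borel_cantelli.

Section dyadic_chaining.
Context {R : realType}.
Implicit Types (f : R -> R) (x y t s : R).

Definition dyadic (j k : nat) : R := k%:R * 2^-1 ^+ j.

Lemma dyadicS j k : dyadic j.+1 k.*2 = dyadic j k.
Proof. by rewrite /dyadic exprS -muln2 natrM; move: (_ ^+ j) => e; field. Qed.

Lemma dyadic_succ j k : dyadic j k.+1 = dyadic j k + 2^-1 ^+ j.
Proof. by rewrite /dyadic -natr1 mulrDl mul1r. Qed.

Lemma pow_half_gt0 j : 0 < 2^-1 ^+ j :> R.
Proof. by rewrite exprn_gt0// invr_gt0. Qed.

Lemma dyadic_le j k l : (dyadic j k <= dyadic j l) = (k <= l)%N.
Proof. by rewrite /dyadic ler_pM2r ?pow_half_gt0// ler_nat. Qed.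

Lemma dyadic_ge0 j k : 0 <= dyadic j k.
Proof. by rewrite /dyadic mulr_ge0// ltW// pow_half_gt0. Qed.

Definition dyadic_floor j t : nat := Num.truncn (t * 2 ^+ j).

Lemma dyadic_floorP j t : 0 <= t ->
  dyadic j (dyadic_floor j t) <= t < dyadic j (dyadic_floor j t) + 2^-1 ^+ j.
Proof.
move=> t0; have /truncn_itv/andP[h1 h2] : 0 <= t * 2 ^+ j by rewrite mulr_ge0// exprn_ge0.
have p2 : 0 < 2 ^+ j :> R by rewrite exprn_gt0.
rewrite -dyadic_succ /dyadic exprVn ler_pdivrMr// ltr_pdivlMr//.
by rewrite h1 h2.
Qed.

(** Refining by one level appends one binary digit. *)
Lemma dyadic_floorS j t : 0 <= t ->
  dyadic_floor j.+1 t = (dyadic_floor j t).*2 \/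
  dyadic_floor j.+1 t = (dyadic_floor j t).*2.+1.
Proof.
move=> t0; have /andP[a1 a2] := dyadic_floorP j t0.
have /andP[b1 b2] := dyadic_floorP j.+1 t0.
rewrite -dyadic_succ in a2; rewrite -dyadic_succ in b2.
have h1 : ((dyadic_floor j t).*2 < (dyadic_floor j.+1 t).+1)%N.
  by rewrite ltnNge -(dyadic_le j.+1) dyadicS -ltNge (le_lt_trans a1).
have h2 : (dyadic_floor j.+1 t < (dyadic_floor j t).+1.*2)%N.
  by rewrite ltnNge -(dyadic_le j.+1) dyadicS -ltNge (le_lt_trans b1).
by move: h1 h2; set x := dyadic_floor _ _; set y := dyadic_floor _ _; lia.
Qed.

End dyadic_chaining.

(** * Hoelder continuity from dyadic increments *)

Section chaining.
Context {R : realType}.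
Implicit Types (f : R -> R) (x y t s : R).

Local Notation dyadic := (@dyadic R).

Lemma dyadic_refine m i k : dyadic (m + i) (k * 2 ^ i) = dyadic m k.
Proof.
rewrite /dyadic exprD natrM natrX.
have : 2 ^+ i * 2^-1 ^+ i = 1 :> R by rewrite -exprMn divff// expr1n.
by move: (2 ^+ i) (2^-1 ^+ i) (2^-1 ^+ m) => a b c ab; rewrite -[RHS]mulr1 -ab; ring.
Qed.

Lemma dyadic_floor_ge j k t : 0 <= t -> (k <= dyadic_floor j t)%N = (dyadic j k <= t).
Proof.
move=> t0; have /andP[a1 a2] := dyadic_floorP j t0; rewrite -dyadic_succ in a2.
apply/idP/idP => h; first by rewrite (le_trans _ a1)// dyadic_le.
by rewrite -ltnS ltnNge -(dyadic_le (R := R) j) -ltNge (le_lt_trans h).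
Qed.

Lemma exists_pow_half_lt x : 0 < x -> exists j, 2^-1 ^+ j < x.
Proof.
move=> x0; have [n xn] : exists n : nat, x^-1 < n%:R.
  by exists (Num.truncn x^-1).+1; rewrite truncnS_gt.
exists n; rewrite exprVn invf_plt ?posrE ?exprn_gt0//.
rewrite (lt_trans xn)// -natrX ltr_nat; exact: ltn_expl.
Qed.

Lemma pow_half_bracket x J : 0 < x -> x <= 2^-1 ^+ J ->
  exists2 j, (J <= j)%N & 2^-1 ^+ j.+1 < x <= 2^-1 ^+ j.
Proof.
move=> x0 xJ; have [n nx] := exists_pow_half_lt x0.
have ex : exists j, (J <= j)%N && (2^-1 ^+ j.+1 < x).
  exists (J + n)%N; rewrite leq_addr/= (le_lt_trans _ nx)//.
  by apply: ler_wiXn2l; rewrite ?invr_ge0 ?invf_le1 ?ler1n//; lia.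
case: (ex_minnP ex) => j /andP[Jj jx] jmin; exists j => //; rewrite jx/=.
have [jJ|jJ] := eqVneq j J; first by rewrite jJ.
have Jj1 : (J <= j.-1)%N by lia.
rewrite leNgt; apply/negP => xj.
have := jmin j.-1; rewrite Jj1 prednK ?xj; last by lia.
by move=> /(_ isT); lia.
Qed.

(** Each finer level moves the truncation of a point by at most one dyadic step, and these steps sum
    geometrically; two points at distance about [2^-1 ^+ j] have equal or adjacent truncations at
    level [j]. The interval is half-open so that the whole dyadic cell of each of its points stays
    inside. *)
Lemma dyadic_chaining f (m A B J : nat) (g : R) : 0 < g -> (m <= J)%N ->
  (forall t e, dyadic m A <= t < dyadic m B -> 0 < e ->
    exists2 r, 0 < r & forall u, dyadic m A <= u < dyadic m B -> `|u - t| < r ->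
      `|f u - f t| <= e) ->
  (forall j k, (J <= j)%N -> dyadic m A <= dyadic j k -> dyadic j k.+1 <= dyadic m B ->
    `|f (dyadic j k.+1) - f (dyadic j k)| <= (2^-1 `^ g) ^+ j) ->
  exists2 C, 0 <= C & forall s t, dyadic m A <= s < dyadic m B ->
    dyadic m A <= t < dyadic m B -> `|s - t| <= 2^-1 ^+ J ->
    `|f s - f t| <= C * `|s - t| `^ g.
Proof.
move=> g0 mJ hc hinc.
set a := dyadic m A in hc hinc *; set b := dyadic m B in hc hinc *.
pose q : R := 2^-1 `^ g.
have q0 : 0 < q by rewrite powR_gt0// invr_gt0.
have q1 : q < 1.
  have <- : 1 `^ g = 1 :> R by rewrite powR1.
  by apply: gt0_ltr_powR; rewrite ?nnegrE ?invr_ge0//; lra.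
have a0 : 0 <= a by exact: dyadic_ge0.
pose fl j t := dyadic j (dyadic_floor j t).
have flP j t : (J <= j)%N -> a <= t < b -> [/\ a <= fl j t, fl j t <= t & fl j t + 2^-1 ^+ j <= b].
  move=> Jj /andP[at_ tb]; have t0 := le_trans a0 at_.
  have /andP[b1 b2] := dyadic_floorP j t0.
  have ref k : dyadic j (k * 2 ^ (j - m))%N = dyadic m k.
    by rewrite -[in RHS](dyadic_refine m (j - m)) subnKC// (leq_trans mJ).
  split => //.
    by rewrite /fl /a -ref dyadic_le dyadic_floor_ge// ref.
  rewrite -dyadic_succ /b -ref dyadic_le ltnNge dyadic_floor_ge// ref.
  by rewrite -ltNge.
have step j t : (J <= j)%N -> a <= t < b -> `|f (fl j.+1 t) - f (fl j t)| <= q ^+ j.+1.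
  move=> Jj hab; have t0 : 0 <= t by case/andP: hab => + _; exact: le_trans.
  have [h1 h2 _] := flP j t Jj hab; have [h3 h4 _] := flP j.+1 t (leqW Jj) hab.
  have [e|e] := dyadic_floorS j t0.
    by rewrite /fl e dyadicS subrr normr0 exprn_ge0// ltW.
  rewrite /fl e -[dyadic j _]dyadicS; apply: hinc; first exact: leqW.
    by rewrite dyadicS.
  by rewrite -e (le_trans h4)// ltW//; case/andP: hab.
(* The sum of the powers of [q] from the first on: the total cost of a chain, relative to its
   starting level. *)
pose c := q / (1 - q).
have c0 : 0 < c by rewrite divr_gt0// subr_gt0.
have cE : c = q + c * q by rewrite /c; field; rewrite gt_eqF// subr_gt0.
have steps j n t : (J <= j)%N -> a <= t < b ->
    `|f (fl (j + n)%N t) - f (fl j t)| <= c * q ^+ j - c * q ^+ (j + n).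
  move=> Jj hab; elim: n => [|n IH]; first by rewrite addn0 !subrr normr0.
  have := step (j + n)%N t (leq_trans Jj (leq_addr _ _)) hab.
  rewrite addnS => h; rewrite -[f _](subrK (f (fl (j + n)%N t))) -addrA.
  rewrite (le_trans (ler_normD _ _))// (le_trans (lerD h IH))//.
  rewrite exprS; move: cE; set u := q ^+ (j + n) => cE.
  rewrite addrCA lerD2l {1}cE; lra.
(* Continuity at [t] closes the chain, since the truncations of [t] converge to [t]. *)
have near j t : (J <= j)%N -> a <= t < b -> `|f t - f (fl j t)| <= c * q ^+ j.
  move=> Jj hab; have t0 : 0 <= t by case/andP: hab => + _; exact: le_trans.
  apply/ler_addgt0Pr => e e0.
  have [r r0 hr] := hc t e hab e0.
  have [n nr] := exists_pow_half_lt r0.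
  have Jjn : (J <= j + n)%N by rewrite (leq_trans Jj)// leq_addr.
  have [h1 h2 _] := flP (j + n)%N t Jjn hab.
  have d1 : `|f (fl (j + n)%N t) - f t| <= e.
    apply: hr; first by rewrite h1 (le_lt_trans h2)//; case/andP: hab.
    rewrite distrC ger0_norm ?subr_ge0//.
    have /andP[_ h] := dyadic_floorP (j + n)%N t0.
    rewrite ltrBlDl (lt_le_trans h)// lerD2l (le_trans _ (ltW nr))//.
    by apply: ler_wiXn2l; rewrite ?invr_ge0 ?invf_le1 ?ler1n// leq_addl.
  have d2 := steps j n t Jj hab.
  have d3 : 0 <= c * q ^+ (j + n) by rewrite mulr_ge0 ?ltW// exprn_gt0.
  rewrite (_ : f t - f (fl j t) =
    (f (fl (j + n)%N t) - f (fl j t)) - (f (fl (j + n)%N t) - f t)); last by ring.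
  rewrite (le_trans (ler_normB _ _))// (le_trans (lerD d2 d1))// lerD2r.
  by rewrite lerBlDr lerDl.
(* Two chains and one middle step; the power of 2 pays for [2^-1 ^+ j < 2 * (t - s)]. *)
exists ((1 + 2 * c) * 2 `^ g).
  by rewrite mulr_ge0 ?powR_ge0// addr_ge0// mulr_ge0// ltW.
suff H s t : a <= s < b -> a <= t < b -> s < t -> t - s <= 2^-1 ^+ J ->
    `|f t - f s| <= (1 + 2 * c) * 2 `^ g * (t - s) `^ g.
  move=> s t hs ht; have [st|ts|->] := ltgtP s t.
  - by rewrite distrC [`|f s - f t|]distrC gtr0_norm ?subr_gt0//; exact: H.
  - by rewrite gtr0_norm ?subr_gt0//; exact: H.
  - by rewrite !subrr normr0 mulr_ge0 ?powR_ge0// mulr_ge0 ?powR_ge0// addr_ge0// mulr_ge0// ltW.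
move=> hs ht st tsJ; have ts0 : 0 < t - s by rewrite subr_gt0.
have [j Jj /andP[j1 j2]] := pow_half_bracket ts0 tsJ.
have s0 : 0 <= s by case/andP: hs => + _; exact: le_trans.
have t0 : 0 <= t by exact: le_trans s0 (ltW st).
have mid : `|f (fl j t) - f (fl j s)| <= q ^+ j.
  have [p1 p2 p3] := flP j s Jj hs; have [p4 p5 p6] := flP j t Jj ht.
  have /andP[u1 u2] := dyadic_floorP j s0; have /andP[u3 u4] := dyadic_floorP j t0.
  have l1 : (dyadic_floor j s <= dyadic_floor j t)%N.
    by rewrite dyadic_floor_ge// (le_trans u1)// ltW.
  have l2 : (dyadic_floor j t < (dyadic_floor j s).+2)%N.
    by rewrite ltnNge -(dyadic_le (R := R) j) -ltNge !dyadic_succ; lra.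
  have [e|ne] := eqVneq (dyadic_floor j t) (dyadic_floor j s).
    by rewrite /fl e subrr normr0 exprn_ge0// ltW.
  have e : dyadic_floor j t = (dyadic_floor j s).+1.
    by apply/eqP; rewrite eqn_leq -ltnS l2/= ltn_neqAle eq_sym ne.
  by rewrite /fl e; apply: hinc => //; rewrite dyadic_succ.
have n1 := near j s Jj hs; have n2 := near j t Jj ht.
have tot : `|f t - f s| <= (1 + 2 * c) * q ^+ j.
  have -> : f t - f s = (f t - f (fl j t)) +
      ((f (fl j t) - f (fl j s)) + (f (fl j s) - f s)) by ring.
  rewrite (le_trans (ler_normD _ _))//.
  have := ler_normD (f (fl j t) - f (fl j s)) (f (fl j s) - f s).
  rewrite [`|f (fl j s) - f s|]distrC; lra.
have c1 : 0 <= 1 + 2 * c by rewrite addr_ge0// mulr_ge0// ltW.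
rewrite (le_trans tot)// -mulrA ler_wpM2l//.
have -> : q ^+ j = (2^-1 ^+ j) `^ g.
  by rewrite /q -powR_mulrn ?powR_ge0// powRAC powR_mulrn ?invr_ge0.
rewrite -powRM ?(ltW ts0)//.
apply: ge0_ler_powR; rewrite ?nnegrE ?(ltW g0) ?exprn_ge0 ?invr_ge0 ?mulr_ge0 ?(ltW ts0)//.
by move: j1; rewrite exprS; move: (_ ^+ j) => z; lra.
Qed.

End chaining.

(** * Local structure of the incremental variance *)

Section exponents.
Context {R : realType}.
Implicit Types (f : R -> R) (t u r rho C : R) (w : R -> R -> R).

Lemma nonneg_ballE (t0 : R) r t : nonneg_ball t0 r t <-> `|t - t0| < r /\ 0 <= t.
Proof. by rewrite /nonneg_ball /ball_ /= distrC. Qed.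

Lemma nonneg_ballS (t0 : R) r (r' : R) t : r <= r' -> nonneg_ball t0 r t -> nonneg_ball t0 r' t.
Proof.
move=> rr /nonneg_ballE[h1 h2]; apply/nonneg_ballE; split=> //.
exact: lt_le_trans h1 rr.
Qed.

Lemma nonneg_ball_dist (t0 : R) r t u : nonneg_ball t0 r t -> nonneg_ball t0 r u ->
  `|t - u| < 2 * r.
Proof.
move=> /nonneg_ballE[h1 _] /nonneg_ballE[h2 _].
have -> : t - u = (t - t0) - (u - t0) by ring.
by rewrite (le_lt_trans (ler_normB _ _))//; lra.
Qed.

Lemma near_right0P (Q : R -> Prop) : (\forall rho \near 0^'+, Q rho) <->
  exists2 r : R, 0 < r & forall rho, 0 < rho -> rho < r -> Q rho.
Proof.
split.
  move=> [r /= r0 hr]; exists r => // rho rho0 rhor; apply: hr => //=.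
  by rewrite sub0r normrN gtr0_norm.
move=> [r r0 hr]; exists r => //= rho; rewrite /= sub0r normrN => h rho0.
by apply: hr => //; move: h; rewrite gtr0_norm.
Qed.

Lemma limsup_finiteP f (t0 : R) w : limsup_finite f t0 w <->
  exists C r, 0 < r /\ forall rho, 0 < rho -> rho < r -> forall t u,
    nonneg_ball t0 rho t -> nonneg_ball t0 rho u -> t != u ->
    `|f t - f u| / w `|t - u| rho <= C.
Proof.
split.
  move=> /ereal_inf_lt[_ [V V0 <-] hV].
  have [r r0 hr] := (near_right0P V).1 V0.
  exists (Num.max 0 (fine (ereal_sup (increment_ratio f t0 w @` V)))), r.
  split=> // rho rho0 rhor t u tB uB tu.
  have h1 : ((`|f t - f u| / w `|t - u| rho)%:E <= increment_ratio f t0 w rho)%E.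
    by apply: ereal_sup_ubound; exists t, u.
  have h2 : (increment_ratio f t0 w rho <= ereal_sup (increment_ratio f t0 w @` V))%E.
    by apply: ereal_sup_ubound; exists rho => //; exact: hr.
  have := le_trans h1 h2; case: (ereal_sup _) hV => [s _|//|_] /=.
    by rewrite lee_fin le_max => ->; rewrite orbT.
  by rewrite leeNy_eq.
move=> [C [r [r0 h]]].
have V0 : (0^'+ : set_system R) [set rho | 0 < rho /\ rho < r].
  by apply/near_right0P; exists r.
apply: (@le_lt_trans _ _ C%:E); last exact: ltry.
apply: (@le_trans _ _ (ereal_sup (increment_ratio f t0 w @` [set rho | 0 < rho /\ rho < r]))).
  by apply: ereal_inf_lbound; exists [set rho | 0 < rho /\ rho < r].
apply: ub_ereal_sup => _ [rho [rho0 rhor] <-].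
apply: ub_ereal_sup => _ [t [u [tB uB tu ->]]].
by rewrite lee_fin; exact: (h rho).
Qed.

Lemma ereal_sup_EFin_gt (S : set R) (x : R) :
  (x%:E < ereal_sup [set y%:E | y in S])%E -> exists2 y, S y & x < y.
Proof.
by move=> /ereal_sup_gt[_ [y Sy <-] xy]; exists y; rewrite // -lte_fin.
Qed.

Lemma local_exponent_gt f (t0 : R) (h : R) : (h%:E < local_exponent f t0)%E ->
  exists beta C r, [/\ h < beta, 0 < r, 0 <= C &
    forall t u, nonneg_ball t0 r t -> nonneg_ball t0 r u ->
      `|f t - f u| <= C * `|t - u| `^ beta].
Proof.
move=> /ereal_sup_EFin_gt[beta /limsup_finiteP[C [r [r0 hC]]] hb].
(* The quotient bound holds on balls of radius strictly below [r], hence the halving. *)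
exists beta, (Num.max C 0), (r / 2); split => //.
- by rewrite divr_gt0.
- by rewrite le_max lexx orbT.
move=> t u tB uB; have [->|tu] := eqVneq t u.
  by rewrite !subrr normr0 mulr_ge0 ?powR_ge0// le_max lexx orbT.
have p0 : 0 < `|t - u| `^ beta by rewrite powR_gt0// normr_gt0 subr_eq0.
rewrite -ler_pdivrMr//.
have := hC (r / 2) _ _ t u tB uB tu; rewrite divr_gt0// => /(_ isT).
have -> : r / 2 < r by lra.
by move=> /(_ isT) h1; rewrite (le_trans h1)// le_max lexx.
Qed.

End exponents.

(** * Incremental variance up to a relative error *)

Section variance.
Context d (T : measurableType d) (R : realType) (P : probability T R).
Variables (H : R -> R) (X : R -> {RV P >-> R}).
Hypothesis H_01 : forall t, 0 <= t -> 0 < H t < 1.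
Hypothesis X2 : forall t, 0 <= t -> L2 P (X t).
Implicit Types (t u : R).

Definition incr_var t u := msq P (fun w => X t w - X u w).

Lemma incr_varC t u : incr_var t u = incr_var u t.
Proof. exact: msq_sym. Qed.

Variable t0 : R.
Hypothesis t00 : 0 <= t0.
Hypothesis X_var : incremental_variance H X t0.
Hypothesis H_beta : ((H t0)%:E < local_exponent H t0)%E.

Lemma H_continuous (e : R) : 0 < e ->
  exists2 r, 0 < r & forall t, nonneg_ball t0 r t -> `|H t - H t0| < e.
Proof.
move=> e0; have [beta [C [r [hb r0 C0 hC]]]] := local_exponent_gt H_beta.
have b0 : 0 < beta by rewrite (lt_trans _ hb)//; case/andP: (H_01 t00).
pose s := (e / (C + 1)) `^ beta^-1.
have C1 : 0 < C + 1 by rewrite ltr_wpDl.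
have s0 : 0 < s by rewrite powR_gt0// divr_gt0.
exists (Num.min r s); first by rewrite lt_min r0.
move=> t tB; have tB' : nonneg_ball t0 r t.
  by apply: nonneg_ballS tB; rewrite ge_min lexx.
have t0B : nonneg_ball t0 r t0 by apply/nonneg_ballE; rewrite subrr normr0.
apply: le_lt_trans (hC t t0 tB' t0B) _.
have ts : `|t - t0| <= s.
  by have /nonneg_ballE[+ _] := tB; rewrite lt_min => /andP[_ /ltW].
apply: (@le_lt_trans _ _ (C * s `^ beta)).
  by rewrite ler_wpM2l//; apply: ge0_ler_powR; rewrite ?nnegrE ?(ltW b0) ?(ltW s0).
rewrite /s -powRrM mulVf ?gt_eqF// powRr1; last by rewrite divr_ge0 ?ltW.
by rewrite mulrA ltr_pdivrMr// mulrC ltr_pM2l// ltrDl.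
Qed.

(** Near [t0], [H t] stays below [beta - g] with [g = (beta - H t0) / 2], so [(H t - H u) ^+ 2] is
    at most a constant times [|t - u|] to the power [2 * g + 2 * H t], and the extra factor tends to
    0. As [incr_var] is symmetric, the exponent may be read at either point. *)
Lemma incr_var_asymp : exists2 K, 0 < K & forall e : R, 0 < e ->
  exists2 r, 0 < r & forall t u, nonneg_ball t0 r t -> nonneg_ball t0 r u ->
    `|incr_var t u - K * `|t - u| `^ (2 * H t)| <= e * (K * `|t - u| `^ (2 * H t)).
Proof.
have [K [L [K0 L0 hV]]] := X_var; exists K => // e e0.
have [beta [C [rH [hb rH0 C0 hC]]]] := local_exponent_gt H_beta.
have /andP[Ht0 _] := H_01 t00.
pose g := (beta - H t0) / 2.
have g0 : 0 < g by rewrite divr_gt0// subr_gt0.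
have [r1 r10 hr1] := H_continuous g0.
(* Half of [e] pays for the remainder in [|t - u|]. The bound by [L] merges the other remainder into
   [2 * L * (H t - H u) ^+ 2], which gets the other half. *)
pose e1 := Num.min (e * K / 2) L.
have e10 : 0 < e1 by rewrite lt_min L0 divr_gt0// mulr_gt0.
have /near_right0P[r2 r20 hr2] := hV e1 e10.
(* r3 makes 2 L C^2 (2 r)^(2 g) <= e K / 2 *)
pose y := e * K / 2 / (2 * L * C ^+ 2 + 1).
have den0 : 0 < 2 * L * C ^+ 2 + 1.
  by rewrite ltr_wpDl// mulr_ge0 ?sqr_ge0// mulr_ge0// ltW.
have y0 : 0 < y by rewrite divr_gt0// divr_gt0// mulr_gt0.
pose r3 := y `^ (2 * g)^-1 / 2.
have r30 : 0 < r3 by rewrite divr_gt0// powR_gt0.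
pose r := Num.min (Num.min (Num.min rH r1) (Num.min (r2 / 2) r3)) 2^-1.
have r0 : 0 < r by rewrite !lt_min rH0 r10 r30 (divr_gt0 r20)// invr_gt0 ltr0n.
exists r => // t u tB uB.
have [rrH rr1 rr2 rr3 rr4] : [/\ r <= rH, r <= r1, r <= r2 / 2, r <= r3 & r <= 2^-1].
  by rewrite /r; split; rewrite !ge_min lexx ?orbT.
have /nonneg_ballE[_ tp] := tB; have /nonneg_ballE[_ up] := uB.
have rlt : r < r2 by rewrite (le_lt_trans rr2)// ltr_pdivrMr//; lra.
have := hr2 r r0 rlt t u tB uB.
have XX : L2 P (fun w => X t w - X u w) by apply: L2B; exact: X2.
rewrite unlock (msqE XX) -EFinB abse_EFin lee_fin -/(incr_var t u).
set V := incr_var t u; set D := `|t - u| `^ (2 * H t) => hVV.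
have D0 : 0 <= D by exact: powR_ge0.
have HH : (H t - H u) ^+ 2 * (2 * L) <= e * K / 2 * D.
  have [tu|tu] := eqVneq t u.
    by rewrite tu subrr expr0n/= mul0r mulr_ge0// ltW// divr_gt0// mulr_gt0.
  have tu0 : 0 < `|t - u| by rewrite normr_gt0 subr_eq0.
  have Hd := hC t u (nonneg_ballS rrH tB) (nonneg_ballS rrH uB).
  have Htd := hr1 t (nonneg_ballS rr1 tB).
  have Htlt : H t < H t0 + g by move: Htd; rewrite ltr_norml => /andP[_]; lra.
  have h1 : (H t - H u) ^+ 2 <= C ^+ 2 * (`|t - u| `^ (2 * g) * D).
    rewrite -[leLHS]real_normK ?num_real//.
    apply: (@le_trans _ _ ((C * `|t - u| `^ beta) ^+ 2)).
      by rewrite ler_sqr ?nnegrE// mulr_ge0 ?powR_ge0.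
    rewrite exprMn ler_wpM2l ?sqr_ge0// -powR_mulrn ?powR_ge0// -powRrM.
    rewrite /D -powRD; last by apply/implyP => _; rewrite gt_eqF.
    have tu1 : `|t - u| <= 1.
      by rewrite ltW// (lt_le_trans (nonneg_ball_dist tB uB))// mulrC -ler_pdivlMr// div1r.
    rewrite ger_powR ?tu0//. 
    rewrite /g in Htlt *; lra.
  have h2 : `|t - u| `^ (2 * g) <= y.
    have tu3 : `|t - u| <= 2 * r3.
      by rewrite ltW// (lt_le_trans (nonneg_ball_dist tB uB))// ler_pM2l.
    apply: (@le_trans _ _ ((2 * r3) `^ (2 * g))).
      by apply: ge0_ler_powR; rewrite ?nnegrE// mulr_ge0// ltW.
    rewrite /r3 mulrC divfK// -powRrM mulVf ?powRr1 ?(ltW y0)//.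
    by rewrite mulf_neq0// gt_eqF.
  have h3 : (2 * L * C ^+ 2) * y <= e * K / 2.
    by rewrite /y mulrCA ler_piMr ?ltW ?divr_gt0 ?mulr_gt0// ltr_pdivrMr// mul1r ltrDl.
  apply: (@le_trans _ _ (C ^+ 2 * (y * D) * (2 * L))).
    rewrite ler_pM2r ?mulr_gt0// (le_trans h1)// ler_wpM2l ?sqr_ge0//.
    by rewrite ler_wpM2r.
  have -> : C ^+ 2 * (y * D) * (2 * L) = 2 * L * C ^+ 2 * y * D by ring.
  by rewrite ler_wpM2r.
have e1K : e1 <= e * K / 2 by rewrite ge_min lexx.
have e1L : e1 <= L by rewrite ge_min lexx orbT.
set S := (H t - H u) ^+ 2 in hVV HH.
have S0 : 0 <= S by exact: sqr_ge0.
have -> : V - K * D = (V - (K * D + L * S)) + L * S by ring.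
rewrite (le_trans (ler_normD _ _))// (le_trans (lerD hVV (lexx _)))//.
rewrite (ger0_norm (mulr_ge0 (ltW L0) S0)) mulrDr.
have q1 : e1 * D <= e * K / 2 * D by rewrite ler_wpM2r.
have q2 : e1 * S <= L * S by rewrite ler_wpM2r.
have -> : e * (K * D) = e * K / 2 * D + e * K / 2 * D by field.
rewrite -addrA lerD// (le_trans _ HH)//.
have -> : S * (2 * L) = L * S + L * S by ring.
by rewrite lerD2r.
Qed.

End variance.

(** * Correlation of increments at separated scales *)

Section scalar.
Context {R : realType}.

(* [vi], [vj] are the variances of two increments from a common point over the
   lengths [a] and [L a], and [V] that of their difference. *)
Lemma cross_bound (K a L h h' e vi vj V M : R) : 0 < K -> 0 < a -> 0 < L ->
  L <= 2^-1 -> 0 < h' <= 1 -> 0 <= e -> e <= L ->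
  `|vi - K * a `^ (2 * h')| <= e * (K * a `^ (2 * h')) ->
  `|V - K * (a * (1 - L)) `^ (2 * h')| <= e * (K * (a * (1 - L)) `^ (2 * h')) ->
  `|vi - K * a `^ (2 * h)| <= e * (K * a `^ (2 * h)) ->
  `|vj - K * (L * a) `^ (2 * h)| <= e * (K * (L * a) `^ (2 * h)) ->
  L `^ (2 * h) <= M -> L `^ (2 * (1 - h)) <= M ->
  ((vi + vj - V) / 2) ^+ 2 <= 100 * M * (vi * vj).
Proof.
move=> K0 a0 L0 L2 /andP[h'0 h'1] e0 eL.
have L1 : 0 < 1 - L by lra.
rewrite (powRM _ (ltW a0) (ltW L1)) (powRM _ (ltW L0) (ltW a0)).
set p := K * a `^ (2 * h'); set m := (1 - L) `^ (2 * h').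
have -> : K * (a `^ (2 * h') * m) = p * m by rewrite mulrA.
set z := L `^ (2 * h); set s := K * a `^ (2 * h).
have -> : K * (z * a `^ (2 * h)) = s * z by rewrite mulrCA mulrC.
have p0 : 0 < p by rewrite mulr_gt0// powR_gt0.
have s0 : 0 < s by rewrite mulr_gt0// powR_gt0.
have z0 : 0 < z by rewrite powR_gt0.
have m1 : m <= 1.
  by rewrite -(powRr0 (1 - L)); apply: ger_powR; rewrite ?L1; lra.
(* The exponent [2 * h'] is at most 2 and the base at most 1; then Bernoulli's inequality. *)
have m2 : 1 - 2 * L <= m.
  apply: (@le_trans _ _ ((1 - L) `^ 2)).
    by rewrite (powR_mulrn 2 (ltW L1)); nra.
  by apply: ger_powR; rewrite ?L1; lra.
have m0 : 0 < m by rewrite powR_gt0.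
(* Two exponents are in play: [vi] and [V] are compared at the same [h'], so that their leading
   terms cancel up to order [L]; [vi] and [vj] are compared at the same [h], which gives their ratio
   [z]. *)
move=> hvi hV hvi2 hvj zM zM2.
have LM : L ^+ 2 <= M * z.
  have -> : L ^+ 2 = L `^ (2 * (1 - h)) * z.
    rewrite /z -powRD; last by apply/implyP => _; rewrite gt_eqF.
    by rewrite -powR_mulrn ?(ltW L0)//; congr (_ `^ _); ring.
  by rewrite ler_pM2r.
have M0 : 0 < M by rewrite (lt_le_trans z0).
clearbody p m z s; clear a a0 h h' h'0 h'1 zM2 K K0.
move: hvi hV hvi2 hvj; rewrite !ler_distl => /andP[a1 a2] /andP[b1 b2] /andP[c1 c2] /andP[d1 d2].
have e2 : e <= 2^-1 by exact: le_trans L2.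
have ep : e * p <= L * p by rewrite ler_pM2r.
have ep2 : e * p <= 2^-1 * p by rewrite ler_pM2r.
have epm : e * (p * m) <= L * p.
  by rewrite (le_trans _ ep)// ler_wpM2l// ler_piMr// ltW.
have pm : p - 2 * L * p <= p * m.
  by rewrite -[X in X - _]mulr1 (mulrC (2 * L)) -mulrBr ler_pM2l.
have pm1 : p * m <= p by rewrite ler_piMr// ltW.
have es : e * s <= 2^-1 * s by rewrite ler_pM2r.
have esz : e * (s * z) <= 2^-1 * (s * z) by rewrite ler_pM2r// mulr_gt0.
have vi0 : 0 < vi by lra.
have pvi : p <= 2 * vi by lra.
have sz0 : 0 < s * z by rewrite mulr_gt0.
have vj0 : 0 < vj by lra.
have hd : `|vi - V| <= 8 * L * vi.
  have : L * p <= L * (2 * vi) by rewrite ler_pM2l.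
  by rewrite ler_norml => q; apply/andP; split; lra.
have hd2 : (vi - V) ^+ 2 <= 64 * (L ^+ 2) * vi ^+ 2.
  rewrite -real_normK ?num_real//.
  have -> : 64 * L ^+ 2 * vi ^+ 2 = (8 * L * vi) ^+ 2 by ring.
  by rewrite ler_sqr ?nnegrE// !mulr_ge0// ltW.
have vjz : vj <= 3 * z * vi.
  have : z * (2^-1 * s) <= z * vi by rewrite ler_pM2l//; lra.
  by lra.
have viz : z * vi <= 3 * vj.
  have : z * vi <= z * (3 / 2 * s) by rewrite ler_pM2l//; lra.
  by lra.
have vij : 0 < vi * vj by rewrite mulr_gt0.
(* The covariance is half of [vj + (vi - V)]. The square of [vj] is small against [vi * vj] because
   [z <= M], which will need [h > 0]; that of [vi - V] because [L ^+ 2 <= M * z], which will need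
   [h < 1]. *)
have k1 : vj ^+ 2 <= 3 * M * (vi * vj).
  apply: (@le_trans _ _ (3 * z * vi * vj)); first by rewrite expr2 ler_pM2r.
  by rewrite -mulrA ler_pM2r// ler_pM2l.
have k2 : L ^+ 2 * vi ^+ 2 <= 3 * M * (vi * vj).
  apply: (@le_trans _ _ (M * z * vi ^+ 2)); first by rewrite ler_pM2r// exprn_gt0.
  have -> : M * z * vi ^+ 2 = (z * vi) * (M * vi) by ring.
  have -> : 3 * M * (vi * vj) = (3 * vj) * (M * vi) by ring.
  by rewrite ler_pM2r// mulr_gt0.
have k3 : ((vi + vj - V) / 2) ^+ 2 <= (vj ^+ 2 + (vi - V) ^+ 2) / 2.
  have := sqr_ge0 (vj - (vi - V)); clear.
  have -> : ((vi + vj - V) / 2) ^+ 2 = (vj ^+ 2 + (vi - V) ^+ 2) / 2 - (vj - (vi - V)) ^+ 2 / 4.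
    by field.
  by move: (_ ^+ 2) => x; lra.
rewrite (le_trans k3)//.
move: hd2 k1 k2; rewrite -mulrA.
have : 0 < M * (vi * vj) by rewrite mulr_gt0.
rewrite -!(mulrA _ M).
move: (M * (vi * vj)) ((vi - V) ^+ 2) (vj ^+ 2) (L ^+ 2 * vi ^+ 2) => A B C D; clear.
lra.
Qed.

Lemma quad_cross_bound (delta E a b x y : R) : 0 <= delta -> 0 <= a -> 0 <= b ->
  E ^+ 2 <= delta ^+ 2 * (a * b) ->
  - (delta / 2 * (x ^+ 2 * a + y ^+ 2 * b)) <= x * y * E.
Proof.
move=> d0 a0 b0 hE.
suff : `|x * y * E| <= delta / 2 * (x ^+ 2 * a + y ^+ 2 * b).
  by rewrite ler_norml => /andP[].
have r0 : 0 <= delta / 2 * (x ^+ 2 * a + y ^+ 2 * b).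
  by rewrite mulr_ge0 ?divr_ge0// addr_ge0// mulr_ge0// sqr_ge0.
rewrite -(ler_pXn2r (n := 2))// ?nnegrE// real_normK ?num_real//.
have h1 : (x * y * E) ^+ 2 <= (x * y) ^+ 2 * (delta ^+ 2 * (a * b)).
  by rewrite exprMn ler_wpM2l// sqr_ge0.
rewrite (le_trans h1)// -subr_ge0.
have -> : (delta / 2 * (x ^+ 2 * a + y ^+ 2 * b)) ^+ 2 - (x * y) ^+ 2 * (delta ^+ 2 * (a * b)) =
  (delta / 2 * (x ^+ 2 * a - y ^+ 2 * b)) ^+ 2 by field.
exact: sqr_ge0.
Qed.

End scalar.

(** * Lower bound for a nearly diagonal quadratic form *)

Section gram.
Context d (T : measurableType d) (R : realType) (P : probability T R).

Lemma msq_sum n (D : 'I_n -> T -> R) (x : 'I_n -> R) : (forall i, L2 P (D i)) ->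
  msq P (fun w => \sum_i x i * D i w) =
  \sum_i \sum_j x i * x j * \int[P]_w (D i w * D j w).
Proof.
move=> D2.
have ii i j : P.-integrable setT (EFin \o (fun w => x i * x j * (D i w * D j w))).
  by apply: integrable_EFinZl => //; exact: L2_mul.
transitivity (\int[P]_w (\sum_i \sum_j x i * x j * (D i w * D j w))).
  apply: eq_Rintegral => w _; rewrite expr2 mulr_suml; apply: eq_bigr => i _.
  by rewrite mulr_sumr; apply: eq_bigr => j _; ring.
rewrite Rintegral_sum//; last by move=> i; exact: integrable_EFin_sum.
apply: eq_bigr => i _; rewrite Rintegral_sum//; apply: eq_bigr => j _.
by rewrite RintegralZl//; exact: L2_mul.
Qed.

(** Polarisation: it expresses covariances of increments by incremental variances, on which alone
    there is information. *)
Lemma covarianceE_msq (Y Z : T -> R) : L2 P Y -> L2 P Z ->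
  \int[P]_w (Y w * Z w) = (msq P Y + msq P Z - msq P (fun w => Y w - Z w)) / 2.
Proof.
move=> Y2 Z2; have [_ iY] := Y2; have [_ iZ] := Z2; have iYZ := L2_mul Y2 Z2.
have -> : msq P (fun w => Y w - Z w) =
    \int[P]_w (Y w ^+ 2 + Z w ^+ 2 - 2 * (Y w * Z w)).
  by apply: eq_Rintegral => w _; ring.
rewrite RintegralB//; last 2 first.
- exact: integrable_EFinD.
- exact: integrable_EFinZl.
rewrite RintegralD// RintegralZl// /msq.
by move: (\int[P]_w (Y w * Z w)) (\int[P]_w Y w ^+ 2) (\int[P]_w Z w ^+ 2) => a b c; field.
Qed.

(** Diagonal dominance: each off-diagonal term costs [delta / 2] of the two diagonal terms it joins,
    in total the fraction [n * delta <= 2^-1]. *)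
Lemma gram_lower n (D : 'I_n -> T -> R) (delta : R) (x : 'I_n -> R) :
  (forall i, L2 P (D i)) -> 0 <= delta -> n%:R * delta <= 2^-1 ->
  (forall i j, i != j ->
    (\int[P]_w (D i w * D j w)) ^+ 2 <= delta ^+ 2 * (msq P (D i) * msq P (D j))) ->
  2^-1 * \sum_i x i ^+ 2 * msq P (D i) <= msq P (fun w => \sum_i x i * D i w).
Proof.
move=> D2 d0 nd hD; rewrite msq_sum//.
pose S := \sum_i x i ^+ 2 * msq P (D i).
have S0 : 0 <= S by apply: sumr_ge0 => i _; rewrite mulr_ge0 ?sqr_ge0 ?msq_ge0.
have step i : x i ^+ 2 * msq P (D i) - delta / 2 * (n%:R * (x i ^+ 2 * msq P (D i)) + S) <=
    \sum_j x i * x j * \int[P]_w (D i w * D j w).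
  have nE : n%:R * (x i ^+ 2 * msq P (D i)) = \sum_(j < n) x i ^+ 2 * msq P (D i).
    by rewrite sumr_const card_ord mulr_natl.
  rewrite nE -big_split/= mulr_sumr (bigD1 i)//= [leRHS](bigD1 i)//= opprD addrA.
  apply: lerD.
    rewrite -expr2.
    have -> : \int[P]_w (D i w * D i w) = msq P (D i) by apply: eq_Rintegral => w _.
    rewrite gerBl mulr_ge0 ?divr_ge0// addr_ge0// mulr_ge0 ?sqr_ge0 ?msq_ge0//.
  rewrite -sumrN; apply: ler_sum => j ji.
  by apply: quad_cross_bound; rewrite ?msq_ge0// hD// eq_sym.
apply: (@le_trans _ _ (\sum_i (x i ^+ 2 * msq P (D i) -
    delta / 2 * (n%:R * (x i ^+ 2 * msq P (D i)) + S)))); last exact: ler_sum.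
rewrite sumrB -/S -mulr_sumr big_split/= -mulr_sumr -/S sumr_const card_ord -[S *+ n]mulr_natl.
have -> : S - delta / 2 * (n%:R * S + n%:R * S) = (1 - n%:R * delta) * S by field.
by rewrite ler_wpM2r//; lra.
Qed.

End gram.

(** * Variance bounds and local nondeterminism near a point *)

Section local_bounds.
Context d (T : measurableType d) (R : realType) (P : probability T R).
Variables (H : R -> R) (X : R -> {RV P >-> R}).
Hypothesis H_01 : forall t, 0 <= t -> 0 < H t < 1.
Hypothesis X2 : forall t, 0 <= t -> L2 P (X t).
Implicit Types (t u : R).

Local Notation incr_var := (incr_var X).

Variable t0 : R.
Hypothesis t00 : 0 <= t0.
Hypothesis X_var : incremental_variance H X t0.
Hypothesis H_beta : ((H t0)%:E < local_exponent H t0)%E.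

Lemma incr_var_le (h : R) : h < H t0 -> exists C r, [/\ 0 < C, 0 < r &
  forall t u, nonneg_ball t0 r t -> nonneg_ball t0 r u ->
    incr_var t u <= C * `|t - u| `^ (2 * h)].
Proof.
move=> hH.
have [K K0 /(_ 1 ltr01)[r1 r10 hr1]] := incr_var_asymp H_01 X2 t00 X_var H_beta.
have Hh : 0 < H t0 - h by rewrite subr_gt0.
have [r2 r20 hr2] := H_continuous H_01 t00 H_beta Hh.
exists (2 * K), (Num.min (Num.min r1 r2) 2^-1); split.
- by rewrite mulr_gt0.
- by rewrite !lt_min r10 r20 invr_gt0 ltr0n.
move=> t u; set r := Num.min _ _ => tB uB.
have [rr1 rr2 rr3] : [/\ r <= r1, r <= r2 & r <= 2^-1].
  by rewrite /r; split; rewrite !ge_min lexx ?orbT.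
have [->|tu] := eqVneq t u.
  rewrite /incr_var /msq; under eq_Rintegral do rewrite subrr expr0n/=.
  by rewrite (Rintegral_cst_probability P 0) mulr_ge0 ?powR_ge0// mulr_ge0// ltW.
have tu0 : 0 < `|t - u| by rewrite normr_gt0 subr_eq0.
have tu1 : `|t - u| <= 1.
  by rewrite ltW// (lt_le_trans (nonneg_ball_dist tB uB))// mulrC -ler_pdivlMr// div1r.
have := hr1 t u (nonneg_ballS rr1 tB) (nonneg_ballS rr1 uB).
rewrite mul1r ler_norml => /andP[_]; rewrite lerBlDr => h1.
apply: (le_trans h1).
have -> : 2 * K * `|t - u| `^ (2 * h) = K * `|t - u| `^ (2 * h) + K * `|t - u| `^ (2 * h) by ring.
suff hle : `|t - u| `^ (2 * H t) <= `|t - u| `^ (2 * h) by rewrite lerD// ler_pM2l.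
have : `|H t - H t0| < H t0 - h by apply: hr2; exact: nonneg_ballS tB.
rewrite ltr_norml => /andP[h2 _].
by apply: ger_powR; rewrite ?tu0//; lra.
Qed.

Definition fan (l : R) (t rho : R) (i : nat) := t + l ^+ i * rho.

Lemma fan_ball (l t rho r : R) i : 0 <= l <= 1 -> 0 < rho ->
  nonneg_ball t0 r t -> nonneg_ball t0 r (t + rho) -> nonneg_ball t0 r (fan l t rho i).
Proof.
move=> /andP[l0 l1] rho0 /nonneg_ballE[h1 tp] /nonneg_ballE[h2 _].
have li0 : 0 <= l ^+ i by rewrite exprn_ge0.
have li1 : l ^+ i <= 1 by rewrite exprn_ile1.
have p0 : 0 <= l ^+ i * rho by rewrite mulr_ge0// ltW.
have p1 : l ^+ i * rho <= rho by rewrite ler_piMl// ltW.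
apply/nonneg_ballE; rewrite /fan; split; last by rewrite addr_ge0.
move: h1 h2; rewrite !ltr_norml => /andP[a1 a2] /andP[b1 b2].
by apply/andP; split; lra.
Qed.

(* Increments from a common point at geometrically separated scales are nearly
   orthogonal, which needs [0 < H t0 < 1]. *)
Lemma local_nondeterminism (h' : R) (n : nat) : H t0 < h' ->
  exists (q : nat) (c r : R), [/\ 0 < c, 0 < r &
  forall t rho, nonneg_ball t0 r t -> nonneg_ball t0 r (t + rho) -> 0 < rho ->
  forall x : 'I_n -> R, (c * rho `^ h') ^+ 2 * \sum_i x i ^+ 2 <=
    msq P (fun w => \sum_i x i * (X (fan (2^-1 ^+ q) t rho i) w - X t w))].
Proof.
move=> hh'; have /andP[H0 H1] := H_01 t00.
have h'0 : 0 < h' by rewrite (lt_trans H0).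
(* Half the distance from [H t0] to 0 and 1: close to [t0] both [H t] and [1 - H t] remain above
   it. *)
pose h1 := Num.min (H t0) (1 - H t0) / 2.
have h10 : 0 < h1 by rewrite divr_gt0// lt_min H0 subr_gt0.
have h1a : h1 <= H t0 / 2 by rewrite ler_pM2r ?invr_gt0// ge_min lexx.
have h1b : h1 <= (1 - H t0) / 2 by rewrite ler_pM2r ?invr_gt0// ge_min lexx orbT.
pose delta : R := (n.+1%:R * 2)^-1.
have n1 : 0 < n.+1%:R * 2 :> R by rewrite mulr_gt0.
have delta0 : 0 < delta by rewrite invr_gt0.
(* A ratio [l <= y] makes [100 * M <= delta ^+ 2], which turns [cross_bound] into the hypothesis of
   [gram_lower]. *)
pose y := (delta ^+ 2 / 100) `^ (2 * h1)^-1.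
have y0 : 0 < y by rewrite powR_gt0// divr_gt0// exprn_gt0.
have [q0 hq0] := exists_pow_half_lt y0.
pose q := q0.+1; pose l : R := 2^-1 ^+ q.
have l0 : 0 < l by rewrite exprn_gt0// invr_gt0.
have l2 : l <= 2^-1.
  by rewrite /l /q exprS ler_piMr ?invr_ge0// exprn_ile1 ?invr_ge0// invf_le1// ler1n.
have l1 : l <= 1 by lra.
have ly : l <= y.
  rewrite (le_trans _ (ltW hq0))// /l /q exprS ler_piMl ?exprn_ge0 ?invr_ge0//.
  by rewrite invf_le1// ler1n.
pose M := l `^ (2 * h1).
have M100 : 100 * M <= delta ^+ 2.
  rewrite mulrC -ler_pdivlMr//.
  apply: (@le_trans _ _ (y `^ (2 * h1))).
    by apply: ge0_ler_powR; rewrite ?nnegrE ?(ltW l0) ?(ltW y0)// mulr_ge0// ltW.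
  rewrite /y -powRrM mulVf ?powRr1 ?divr_ge0 ?exprn_ge0 ?(ltW delta0)//.
  by rewrite mulf_neq0// gt_eqF.
(* The relative error must not exceed any of the ratios [l ^+ (j - i)] between two scales of the
   fan. *)
pose e := l ^+ n.+1.
have e0 : 0 < e by rewrite exprn_gt0.
have [K K0 hK] := incr_var_asymp H_01 X2 t00 X_var H_beta.
have [r1 r10 hr1] := hK e e0.
have g0 : 0 < Num.min h1 (h' - H t0) by rewrite lt_min h10 subr_gt0.
have [r2 r20 hr2] := H_continuous H_01 t00 H_beta g0.
pose r := Num.min (Num.min r1 r2) 2^-1.
have r0 : 0 < r by rewrite !lt_min r10 r20 invr_gt0 ltr0n.
have [rr1 rr2 rr3] : [/\ r <= r1, r <= r2 & r <= 2^-1].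
  by rewrite /r; split; rewrite !ge_min lexx ?orbT.
have Hb t : nonneg_ball t0 r t -> [/\ h1 <= H t, h1 <= 1 - H t & H t <= h'].
  move=> tB; have := hr2 t (nonneg_ballS rr2 tB); rewrite lt_min => /andP[].
  rewrite !ltr_norml => /andP[u1 u2] /andP[u3 u4].
  by split; lra.
have lM k h : h1 <= h -> (l ^+ k.+1) `^ (2 * h) <= M.
  move=> hh; apply: (@le_trans _ _ (l `^ (2 * h))).
    apply: ge0_ler_powR; rewrite ?nnegrE ?exprn_ge0 ?(ltW l0)//; first lra.
    by rewrite exprS ler_piMr ?(ltW l0)// exprn_ile1// ltW.
  by apply: ger_powR; [rewrite l0 l1|lra].
(* The smallest scale is above [l ^+ n * rho]; one factor 1/2 is lost in [gram_lower], the other in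
   the variance asymptotics. *)
pose c := Num.sqrt (K / 4 * (l ^+ n) `^ (2 * h')).
have c20 : 0 < K / 4 * (l ^+ n) `^ (2 * h').
  by rewrite mulr_gt0 ?divr_gt0// powR_gt0// exprn_gt0.
exists q, c, r; split => //; first by rewrite sqrtr_gt0.
move=> t rho tB trB rho0 x; rewrite -/l.
have fB i : nonneg_ball t0 r (fan l t rho i).
  by apply: fan_ball => //; rewrite (ltW l0) l1.
have fP i : 0 <= fan l t rho i by have /nonneg_ballE[] := fB i.
have tP : 0 <= t by have /nonneg_ballE[] := tB.
pose D (i : 'I_n) w := X (fan l t rho i) w - X t w.
have D2 i : L2 P (D i) by apply: L2B; exact: X2.
pose a i := l ^+ i * rho.
have a0 i : 0 < a i by rewrite mulr_gt0// exprn_gt0.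
have rho1 : rho <= 1.
  have := nonneg_ball_dist trB tB; rewrite addrAC subrr add0r gtr0_norm// => h.
  by rewrite ltW// (lt_le_trans h)// mulrC -ler_pdivlMr// div1r.
have asy u v : nonneg_ball t0 r u -> nonneg_ball t0 r v ->
    `|incr_var u v - K * `|u - v| `^ (2 * H u)| <= e * (K * `|u - v| `^ (2 * H u)).
  by move=> uB vB; apply: hr1; exact: nonneg_ballS rr1 _.
have vE i : msq P (D i) = incr_var t (fan l t rho i) by rewrite incr_varC.
have dist1 i : `|t - fan l t rho i| = a i.
  by rewrite /fan opprD addrA subrr sub0r normrN (gtr0_norm (a0 i)).
have v1 i : `|msq P (D i) - K * a i `^ (2 * H t)| <= e * (K * a i `^ (2 * H t)).
  by rewrite vE -dist1; exact: asy.
(* The same variance with its exponent read at the fan point, where the variance of [D i - D j] can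
   also be read. *)
have v2 i : `|msq P (D i) - K * a i `^ (2 * H (fan l t rho i))|
    <= e * (K * a i `^ (2 * H (fan l t rho i))).
  by rewrite vE incr_varC -dist1 [`|t - _|]distrC; exact: asy.
have cross (i j : 'I_n) : (i < j)%N ->
    (\int[P]_w (D i w * D j w)) ^+ 2 <= delta ^+ 2 * (msq P (D i) * msq P (D j)).
  move=> ij; rewrite covarianceE_msq//.
  have -> : msq P (fun w => D i w - D j w) = incr_var (fan l t rho i) (fan l t rho j).
    by apply: eq_Rintegral => w _; congr (_ ^+ 2); rewrite /D; ring.
  have [k jE] : exists k, j = (i + k.+1)%N :> nat.
    by exists (j - i).-1; rewrite prednK ?subn_gt0// subnKC// ltnW.
  have [ha hb _] := Hb _ tB; have [hc hd _] := Hb _ (fB i).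
  pose L := l ^+ k.+1.
  have L0 : 0 < L by rewrite exprn_gt0.
  have aj : a j = L * a i by rewrite /a /L jE exprD; ring.
  have L12 : L <= 2^-1.
    by rewrite (le_trans _ l2)// /L exprS ler_piMr ?(ltW l0)// exprn_ile1// ltW.
  have distij : `|fan l t rho i - fan l t rho j| = a i * (1 - L).
    have -> : fan l t rho i - fan l t rho j = a i * (1 - L).
      by rewrite mulrBr mulr1 (mulrC _ L) -aj /fan /a; ring.
    rewrite ger0_norm// mulr_ge0 ?(ltW (a0 i))// subr_ge0 (le_trans L12)//.
    by rewrite invf_le1// ler1n.
  have Hfi := H_01 (fP i).
  apply: (le_trans (@cross_bound R K (a i) L (H t) (H (fan l t rho i)) e _ _ _ M
     K0 (a0 i) L0 L12 _ (ltW e0) _ (v2 i) _ (v1 i) _ _ _)).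
  - by have /andP[-> /ltW ->] := Hfi.
  - rewrite /e /L; apply: ler_wiXn2l; rewrite ?(ltW l0)//.
    have kj : (k <= j)%N by rewrite jE (leq_trans (leqnSn k))// leq_addl.
    by rewrite ltnS (leq_trans kj)// ltnW.
  - by rewrite -distij; exact: asy.
  - by rewrite -aj; exact: v1.
  - exact: lM.
  - exact: lM.
  - by rewrite ler_wpM2r// mulr_ge0// msq_ge0.
have := @gram_lower _ _ _ P n D delta x D2 (ltW delta0).
have nd : n%:R * delta <= 2^-1.
  by rewrite /delta invfM mulrA ler_piMl ?invr_ge0// ler_pdivrMr// mul1r ler_nat.
move=> /(_ nd) gl; apply: le_trans (gl _); last first.
  move=> i j ij; have [lt|lt|eq] := ltngtP i j; first exact: cross.
  - rewrite (mulrC (msq P (D i))) (_ : \int[P]_w _ = \int[P]_w (D j w * D i w)); first exact: cross.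
    by apply: eq_Rintegral => w _; rewrite mulrC.
  - by move: ij; rewrite (val_inj eq) eqxx.
rewrite !mulr_sumr; apply: ler_sum => i _.
rewrite (_ : 2^-1 * (x i ^+ 2 * msq P (D i)) = 2^-1 * msq P (D i) * x i ^+ 2); last by ring.
apply: ler_wpM2r; first exact: sqr_ge0.
have [hHt hHt2 hHt3] := Hb _ tB.
have e2 : e <= 2^-1.
  by rewrite (le_trans _ l2)// /e exprS ler_piMr ?(ltW l0)// exprn_ile1// ltW.
have p0 : 0 <= K * a i `^ (2 * H t) by rewrite mulr_ge0 ?powR_ge0// ltW.
have low : 2^-1 * (K * a i `^ (2 * H t)) <= msq P (D i).
  have lem (x1 x2 x3 : R) : x1 <= 2^-1 * x3 -> - x1 <= x2 - x3 -> 2^-1 * x3 <= x2.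
    by lra.
  have := v1 i; rewrite ler_norml => /andP[+ _]; apply: lem.
  by rewrite ler_wpM2r.
apply: (@le_trans _ _ (2^-1 * (2^-1 * (K * a i `^ (2 * H t))))); last first.
  by rewrite ler_pM2l// invr_gt0.
have c2E : c ^+ 2 = K / 4 * (l ^+ n) `^ (2 * h') by rewrite /c sqr_sqrtr ?(ltW c20).
rewrite exprMn c2E.
have -> : (rho `^ h') ^+ 2 = rho `^ (2 * h').
  by rewrite -powR_mulrn ?powR_ge0// -powRrM mulrC.
rewrite -[K / 4 * _ * _]mulrA -powRM ?exprn_ge0 ?(ltW l0) ?(ltW rho0)//.
have -> : 2^-1 * (2^-1 * (K * a i `^ (2 * H t))) = K / 4 * a i `^ (2 * H t) by field.
rewrite ler_pM2l ?divr_gt0//.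
apply: (@le_trans _ _ (a i `^ (2 * h'))).
  apply: ge0_ler_powR; rewrite ?nnegrE ?(ltW (a0 i)) ?mulr_ge0 ?exprn_ge0 ?(ltW l0)
    ?(ltW rho0) ?(ltW h'0)//.
  rewrite /a ler_pM2r//; apply: ler_wiXn2l; rewrite ?(ltW l0)//; exact: ltnW.
apply: ger_powR; last by lra.
rewrite a0 /a mulr_ile1 ?exprn_ge0 ?(ltW l0) ?(ltW rho0)//.
by rewrite exprn_ile1// ltW.
Qed.

End local_bounds.

(** * From path bounds to the frontier *)

Section frontier.
Context {R : realType}.
Variables (f : R -> R) (t0 h : R).
Hypothesis h_gt0 : 0 < h.
Hypothesis f_holder : forall g : R, g < h -> exists C r, 0 < r /\
  forall t u, nonneg_ball t0 r t -> nonneg_ball t0 r u ->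
    `|f t - f u| <= C * `|t - u| `^ g.
Hypothesis f_osc : forall alpha : R, h < alpha ->
  ~ limsup_finite f t0 (fun _ rho => rho `^ alpha).

(** Hoelder continuity of order [sigma - s' < h] is enough: as [- s' >= 0] and [|t - u| < 2 * rho],
    the excess power of [|t - u|] is traded for one of [rho]. *)
Lemma microlocal_admissible (s' sigma : R) : s' <= 0 -> sigma < h + s' ->
  limsup_finite f t0 (fun x rho => x `^ sigma * rho `^ (- s')).
Proof.
move=> s0 sh; have [|C [r [r0 hC]]] := @f_holder (sigma - s'); first by lra.
apply/limsup_finiteP; exists (Num.max C 0 * 2 `^ (- s')), r; split => //.
move=> rho rho0 rhor t u tB uB tu.
have tu0 : 0 < `|t - u| by rewrite normr_gt0 subr_eq0.
rewrite ler_pdivrMr; last by rewrite mulr_gt0// powR_gt0.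
have C0 : 0 <= Num.max C 0 by rewrite le_max lexx orbT.
apply: (le_trans (hC t u _ _)).
- exact: nonneg_ballS (ltW rhor) tB.
- exact: nonneg_ballS (ltW rhor) uB.
rewrite powRD; last by apply/implyP => _; rewrite gt_eqF.
have -> : Num.max C 0 * 2 `^ (- s') * (`|t - u| `^ sigma * rho `^ (- s')) =
  Num.max C 0 * (`|t - u| `^ sigma * (2 `^ (- s') * rho `^ (- s'))) by ring.
apply: (@le_trans _ _ (Num.max C 0 * (`|t - u| `^ sigma * `|t - u| `^ (- s')))).
  by rewrite ler_wpM2r ?mulr_ge0 ?powR_ge0// le_max lexx.
rewrite ler_wpM2l// ler_wpM2l ?powR_ge0// -powRM ?(ltW rho0)//.
apply: ge0_ler_powR; rewrite ?nnegrE ?mulr_ge0 ?(ltW rho0) ?oppr_ge0//.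
exact: ltW (nonneg_ball_dist tB uB).
Qed.

(** The opposite trade: as [sigma >= 0], the whole weight is at most a constant times [rho] to the
    power [sigma - s' > h], so the oscillation would be too small. *)
Lemma microlocal_not_admissible (s' sigma : R) : 0 <= sigma -> h + s' < sigma ->
  ~ limsup_finite f t0 (fun x rho => x `^ sigma * rho `^ (- s')).
Proof.
move=> sig0 hs /limsup_finiteP[C [r [r0 hC]]].
apply: (@f_osc (sigma - s')); first by lra.
apply/limsup_finiteP; exists (Num.max C 0 * 2 `^ sigma), r; split => //.
move=> rho rho0 rhor t u tB uB tu.
have tu0 : 0 < `|t - u| by rewrite normr_gt0 subr_eq0.
have := hC rho rho0 rhor t u tB uB tu.
rewrite !ler_pdivrMr ?mulr_gt0 ?powR_gt0// => hh; apply: (le_trans hh).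
rewrite powRD; last by apply/implyP => _; rewrite gt_eqF.
have -> : Num.max C 0 * 2 `^ sigma * (rho `^ sigma * rho `^ (- s')) =
  Num.max C 0 * ((2 `^ sigma * rho `^ sigma) * rho `^ (- s')) by ring.
have C0 : 0 <= Num.max C 0 by rewrite le_max lexx orbT.
apply: (@le_trans _ _ (Num.max C 0 * (`|t - u| `^ sigma * rho `^ (- s')))).
  by rewrite ler_wpM2r ?mulr_ge0 ?powR_ge0// le_max lexx.
rewrite ler_wpM2l// ler_wpM2r ?powR_ge0// -powRM ?(ltW rho0)//.
apply: ge0_ler_powR; rewrite ?nnegrE ?mulr_ge0 ?(ltW rho0)//.
exact: ltW (nonneg_ball_dist tB uB).
Qed.

Lemma sup_EFin_ge (S : set R) (x : R) : (forall y, y < x -> S y) ->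
  (x%:E <= ereal_sup [set y%:E | y in S])%E.
Proof.
move=> hS; apply/lee_subgt0Pr => e e0.
apply: ereal_sup_ubound; exists (x - e) => //; apply: hS; lra.
Qed.

Lemma sup_EFin_le (S : set R) (x : R) : (forall y, x < y -> ~ S y) ->
  (ereal_sup [set y%:E | y in S] <= x%:E)%E.
Proof.
move=> hS; apply: ub_ereal_sup => _ [y Sy <-]; rewrite lee_fin leNgt.
by apply/negP => /hS.
Qed.

Lemma frontier_graph_line :
  frontier_graph f t0 `&` region_D = [set p : R * R | p.2 = h + p.1] `&` region_D.
Proof.
apply/seteqP; split => -[s' sigma] [hp hD]; split => //;
    have [/= /andP[s1 s2] /andP[g1 g2]] := hD.
  have lo : ((h + s')%:E <= microlocal_frontier f t0 s')%E.
    by apply: sup_EFin_ge => y hy; apply: microlocal_admissible => //; exact: ltW.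
  (* [microlocal_not_admissible] excludes only nonnegative orders, hence the maximum with 0; it is
     harmless since [sigma > 0] in [region_D]. *)
  have hi : (microlocal_frontier f t0 s' <= (Num.max 0 (h + s'))%:E)%E.
    apply: sup_EFin_le => y; rewrite gt_max => /andP[y0 yh].
    by apply: microlocal_not_admissible => //; exact: ltW.
  have hp' : microlocal_frontier f t0 s' = sigma%:E := hp.
  rewrite hp' !lee_fin in lo hi.
  move: hi; rewrite le_max leNgt g1/= => hi.
  by apply/eqP; rewrite eq_le hi lo.
have hp' : sigma = h + s' := hp.
have E : microlocal_frontier f t0 s' = sigma%:E.
  rewrite hp'; apply/eqP; rewrite eq_le; apply/andP; split.
    apply: sup_EFin_le => y hy; apply: microlocal_not_admissible => //.
    by rewrite ltW// (lt_trans _ hy)// -hp'.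
  by apply: sup_EFin_ge => y hy; apply: microlocal_admissible => //; exact: ltW.
exact: E.
Qed.

Lemma pointwise_exponentE : pointwise_exponent f t0 = h%:E.
Proof.
apply/eqP; rewrite eq_le; apply/andP; split; first exact: sup_EFin_le.
apply: sup_EFin_ge => y hy.
(* A positive order is wanted, for [|t - u| < 2 * rho] to pass to the power; [rho < 1] then brings
   [g] back to [y]. *)
pose g := Num.max y (h / 2).
have gh : g < h by rewrite gt_max hy ltr_pdivrMr//= mulr_natr mulr2n ltrDl.
have g0 : 0 < g by rewrite lt_max divr_gt0// orbT.
have [C [r [r0 hC]]] := f_holder gh.
apply/limsup_finiteP; exists (Num.max C 0 * 2 `^ g), (Num.min r 1).
split; first by rewrite lt_min r0 ltr01.
move=> rho rho0; rewrite lt_min => /andP[rhor rho1] t u tB uB tu.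
rewrite ler_pdivrMr ?powR_gt0//.
have C0 : 0 <= Num.max C 0 by rewrite le_max lexx orbT.
apply: (le_trans (hC t u _ _)).
- exact: nonneg_ballS (ltW rhor) tB.
- exact: nonneg_ballS (ltW rhor) uB.
apply: (@le_trans _ _ (Num.max C 0 * `|t - u| `^ g)).
  by rewrite ler_wpM2r ?powR_ge0// le_max lexx.
rewrite -mulrA ler_wpM2l//.
apply: (@le_trans _ _ ((2 * rho) `^ g)).
  apply: ge0_ler_powR; rewrite ?nnegrE ?mulr_ge0 ?(ltW rho0) ?(ltW g0)//.
  exact: ltW (nonneg_ball_dist tB uB).
rewrite powRM ?(ltW rho0)// ler_wpM2l ?powR_ge0//.
apply: ger_powR; first by rewrite rho0 ltW.
by rewrite /g le_max lexx.
Qed.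

(** The case [s' = 0] of the two microlocal lemmas. *)
Lemma local_exponentE : local_exponent f t0 = h%:E.
Proof.
have e alpha : (fun x rho : R => x `^ alpha * rho `^ (- 0)) = (fun x _ => x `^ alpha).
  by apply/funext => x; apply/funext => rho; rewrite oppr0 powRr0 mulr1.
apply/eqP; rewrite eq_le; apply/andP; split.
  apply: sup_EFin_le => y hy; rewrite /= -e; apply: microlocal_not_admissible.
    by rewrite ltW// (lt_trans h_gt0).
  by rewrite addr0.
by apply: sup_EFin_ge => y hy; rewrite /= -e; apply: microlocal_admissible; rewrite ?addr0.
Qed.

End frontier.

Section box.
Context {R : realType}.
Implicit Types (t r : R).

(* The predecessor is truncated: near the origin the box starts at 0. *)
Lemma box_around (t0 r : R) : 0 <= t0 -> 0 < r -> exists m k,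
  [/\ forall t, dyadic m k.-1 <= t <= dyadic m k.+2 -> nonneg_ball t0 r t,
      forall t, nonneg_ball t0 (2^-1 ^+ m) t -> dyadic m k.-1 <= t < dyadic m k.+2 &
      dyadic m k <= t0 < dyadic m k.+1].
Proof.
(* The box is the cell of [t0] with its neighbours, so its points are within two cell lengths of
   [t0]. *)
move=> t00 r0; have [m mr] := exists_pow_half_lt (divr_gt0 r0 (ltr0n R 2)).
have m0 := pow_half_gt0 (R := R) m.
have /andP[k1 k2] := dyadic_floorP m t00; set k := dyadic_floor m t0 in k1 k2 *.
have km : dyadic m k - 2^-1 ^+ m <= dyadic m k.-1 :> R.
  case: (k) => [|k'] /=; first by rewrite gerBl ltW.
  by rewrite dyadic_succ addrK.
exists m, k; rewrite !dyadic_succ; split.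
- move=> t /andP[a1 a2]; apply/nonneg_ballE; split.
    by rewrite ltr_norml; apply/andP; split; lra.
  exact: le_trans (dyadic_ge0 _ _) a1.
- move=> t /nonneg_ballE[]; rewrite ltr_norml => /andP[a1 a2] tp; apply/andP; split; last by lra.
  case: (k) k1 => [|k'] /= k1; first by rewrite /dyadic mul0r.
  by rewrite dyadic_succ in k1; lra.
- by rewrite k1.
Qed.

Lemma pow_half_powR_le j (s : R) : 2 <= s -> (2^-1 ^+ j) `^ s <= 4^-1 ^+ j.
Proof.
move=> s2; apply: (@le_trans _ _ ((2^-1 ^+ j) `^ 2)).
  apply: ger_powR => //; rewrite pow_half_gt0/=.
  by rewrite exprn_ile1 ?invr_ge0// invf_le1// ler1n.
rewrite powR_mulrn ?exprn_ge0 ?invr_ge0// -exprM mulnC exprM.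
by rewrite (_ : 2^-1 ^+ 2 = 4^-1 :> R)//; field.
Qed.

Lemma powR_half_exp j (s : R) : (2^-1 `^ s) ^+ j = (2^-1 ^+ j) `^ s.
Proof. by rewrite -powR_mulrn ?powR_ge0// powRAC powR_mulrn ?invr_ge0. Qed.

Lemma dyadic_index_lt j k m B : dyadic j k.+1 <= dyadic m B :> R -> (k < B * 2 ^ j)%N.
Proof.
move=> h; rewrite -(dyadic_le (R := R) j) (le_trans h)//.
rewrite -[j in leRHS]add0n dyadic_refine /dyadic expr0 mulr1 ler_piMr//.
by rewrite exprn_ile1 ?invr_ge0// invf_le1// ler1n.
Qed.

End box.

(** * Almost sure estimates on a dyadic box *)

Section almost_sure.
Context d (T : measurableType d) (R : realType) (P : probability T R).
Variable W : set R -> {RV P >-> R}.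
Hypothesis W_white : white_noise W.
Variable X : R -> {RV P >-> R}.
Hypothesis X_wiener : forall t, 0 <= t -> wiener W (X t).
Variables (m A B : nat).
Local Notation a := (dyadic m A : R).
Local Notation b := (dyadic m B : R).

Lemma kolmogorov_ae (h g C : R) : g < h -> 0 < C ->
  (forall t u, a <= t <= b -> a <= u <= b -> incr_var X t u <= C * `|t - u| `^ (2 * h)) ->
  {ae P, forall w, exists J, forall j k, (J <= j)%N ->
    a <= dyadic j k -> dyadic j k.+1 <= b ->
    `|X (dyadic j k.+1) w - X (dyadic j k) w| <= (2^-1 `^ g) ^+ j}.
Proof.
move=> gh C0 hV.
(* The tail of power [N] has exponent [2 * (h - g) * N] in [2^-1 ^+ j]; it must be at least 2 to
   reach [4^-1 ^+ j]. *)
pose N := (Num.truncn (h - g)^-1).+1.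
have hg0 : 0 < h - g by rewrite subr_gt0.
have N1 : 1 <= N%:R * (h - g).
  by rewrite -ler_pdivrMr// div1r /N ltW// truncnS_gt.
have [K K0 hK] := wiener_tail_pow W_white N.
pose E j k := if (a <= dyadic j k) && (dyadic j k.+1 <= b) then
  [set w | (2^-1 `^ g) ^+ j <= `|X (dyadic j k.+1) w - X (dyadic j k) w|] else set0.
have wI j k : wiener W (fun w => X (dyadic j k.+1) w - X (dyadic j k) w).
  by apply: wienerB; apply: X_wiener; exact: dyadic_ge0.
have mE j k : measurable (E j k).
  rewrite /E; case: ifP => // _; apply/measurable_ge_cst/measurable_norm.
  by case: (wI j k).
have EP j k : (P (E j k) <= (K * C ^+ N * 4^-1 ^+ j)%:E)%E.
  have KC0 : 0 <= K * C ^+ N by rewrite mulr_ge0 ?exprn_ge0// ltW.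
  rewrite /E; case: ifPn => [/andP[h1 h2]|_]; last first.
    by rewrite measure0 lee_fin mulr_ge0// exprn_ge0// invr_ge0.
  have dS : dyadic j k <= dyadic j k.+1 :> R by rewrite dyadic_le.
  have Vle : msq P (fun w => X (dyadic j k.+1) w - X (dyadic j k) w) <=
      C * (2^-1 ^+ j) `^ (2 * h).
    have -> : 2^-1 ^+ j = `|dyadic j k.+1 - dyadic j k| :> R.
      by rewrite dyadic_succ addrAC subrr add0r ger0_norm// ltW// pow_half_gt0.
    apply: hV; first by rewrite h2 (le_trans h1).
    by rewrite h1 (le_trans dS).
  have p0 : 0 < 2^-1 ^+ j :> R by exact: pow_half_gt0.
  apply: (le_trans (hK _ _ _ (wI j k) Vle _ _)).
  - by rewrite mulr_gt0// powR_gt0.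
  - by rewrite exprn_gt0// powR_gt0// invr_gt0.
  rewrite lee_fin -[leRHS]mulrA ler_pM2l// powR_half_exp.
  rewrite -[(_ `^ g) ^+ 2]powR_mulrn ?powR_ge0// -powRrM.
  rewrite -mulrA -powRB; last by apply/implyP => _; rewrite gt_eqF.
  rewrite exprMn ler_pM2l ?exprn_gt0// -powR_mulrn ?powR_ge0// -powRrM pow_half_powR_le//.
  have -> : (2 * h - g * 2) * N%:R = 2 * (N%:R * (h - g)) by ring.
  by rewrite -[leLHS]mulr1 ler_pM2l.
have KC0 : 0 <= K * C ^+ N by rewrite mulr_ge0 ?exprn_ge0// ltW.
apply: filterS (dyadic_borel_cantelli KC0 mE (fun j k (_ : (0 <= j)%N) _ => EP j k)).
move=> w [J hJ]; exists J => j k Jj h1 h2.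
have := hJ j Jj k (dyadic_index_lt h2).
by rewrite /E h1 h2 /= => /negP; rewrite -ltNge => /ltW.
Qed.

(** With [u = c * rho]^ h[and]delta = rho [^ alpha], the small-ball bound has exponent
    [(alpha - h) * n] in [rho = 2^-1 ^+ j]; the value 2 gives the rate [4^-1 ^+ j]. *)
Lemma oscillation_ae (n q : nat) (h alpha c : R) : 0 < c -> 2 <= (alpha - h) * n%:R ->
  (forall t rho, a <= t -> t + rho <= b -> 0 < rho -> forall x : 'I_n -> R,
    (c * rho `^ h) ^+ 2 * \sum_i x i ^+ 2 <=
    msq P (fun w => \sum_i x i * (X (fan (2^-1 ^+ q) t rho i) w - X t w))) ->
  {ae P, forall w, exists J, forall j k, (J <= j)%N ->
    a <= dyadic j k -> dyadic j k.+1 <= b ->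
    ~ forall i : 'I_n, `|X (fan (2^-1 ^+ q) (dyadic j k) (2^-1 ^+ j) i) w -
        X (dyadic j k) w| <= (2^-1 ^+ j) `^ alpha}.
Proof.
move=> c0 hn hV.
have [K K0 hK] := small_ball_pow W_white n.
pose D j k (i : 'I_n) w := X (fan (2^-1 ^+ q) (dyadic j k) (2^-1 ^+ j) i) w - X (dyadic j k) w.
pose E j k := if (a <= dyadic j k) && (dyadic j k.+1 <= b) then
  [set w | forall i : 'I_n, `|D j k i w| <= (2^-1 ^+ j) `^ alpha] else set0.
have wD j k i : wiener W (D j k i).
  apply: wienerB; apply: X_wiener; last exact: dyadic_ge0.
  by rewrite /fan addr_ge0 ?dyadic_ge0// mulr_ge0 ?exprn_ge0 ?invr_ge0.
have mE j k : measurable (E j k).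
  rewrite /E; case: ifP => // _; apply: measurable_all_small => i.
  by case: (wD j k i).
have KC0 : 0 <= K * (c^-1) ^+ n by rewrite mulr_ge0 ?exprn_ge0 ?invr_ge0// ltW.
have EP j k : (P (E j k) <= (K * (c^-1) ^+ n * 4^-1 ^+ j)%:E)%E.
  rewrite /E; case: ifPn => [/andP[h1 h2]|_]; last first.
    by rewrite measure0 lee_fin mulr_ge0// exprn_ge0// invr_ge0.
  have p0 : 0 < 2^-1 ^+ j :> R by exact: pow_half_gt0.
  apply: (le_trans (hK (D j k) _ (c * (2^-1 ^+ j) `^ h) _ _ (wD j k) _)).
  - by rewrite powR_gt0.
  - by rewrite mulr_gt0// powR_gt0.
  - by apply: hV => //; rewrite -dyadic_succ.
  rewrite lee_fin -[leRHS]mulrA ler_pM2l// invfM mulrCA exprMn ler_pM2l ?exprn_gt0 ?invr_gt0//.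
  rewrite -powRB; last by apply/implyP => _; rewrite gt_eqF.
  by rewrite -powR_mulrn ?powR_ge0// -powRrM pow_half_powR_le.
apply: filterS (dyadic_borel_cantelli KC0 mE (fun j k (_ : (0 <= j)%N) _ => EP j k)).
move=> w [J hJ]; exists J => j k Jj h1 h2.
have := hJ j Jj k (dyadic_index_lt h2).
by rewrite /E h1 h2.
Qed.

End almost_sure.

Lemma ae_forall_countable d (T : measurableType d) (R : realType)
  (mu : {measure set T -> \bar R}) (I : countType) (Q : I -> T -> Prop) :
  (forall i, {ae mu, forall w, Q i w}) -> {ae mu, forall w, forall i, Q i w}.
Proof.
move=> hQ.
have : forall n, {ae mu, forall w, if unpickle n is Some i then Q i w else True}.
  by move=> n; case: (unpickle n) => [i|]; [exact: hQ|exact: aeW].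
move=> /ae_foralln; apply: filterS => w hw i.
by have := hw (pickle i); rewrite pickleK.
Qed.

Lemma within_continuous_eps (R : realType) (I : set R) (f : R -> R) (t e : R) :
  {within I, continuous f} -> I t -> 0 < e ->
  exists2 r, 0 < r & forall u, I u -> `|u - t| < r -> `|f u - f t| <= e.
Proof.
move=> /subspace_continuousP cf It e0.
have /cvgrPdist_le/(_ e e0) := cf t It.
move=> [r /= r0 hr]; exists r => // u Iu ur.
by rewrite distrC; apply: hr => //=; rewrite distrC.
Qed.

(** * From dyadic estimates to a given point of a path *)

Section sample_paths.
Context {R : realType}.

(** Chaining needs a positive order [g]; the weaker order [g0], of any sign, follows because the
    distances are at most 1. *)
Lemma path_holder (f : R -> R) (t0 g0 g : R) (I : set R) : 0 <= t0 -> 0 < g -> g0 <= g ->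
  {within I, continuous f} ->
  forall m k J,
  (forall t, dyadic m k.-1 <= t <= dyadic m k.+2 -> I t) ->
  (forall t, nonneg_ball t0 (2^-1 ^+ m) t -> dyadic m k.-1 <= t < dyadic m k.+2) ->
  (forall j l, (J <= j)%N -> dyadic m k.-1 <= dyadic j l :> R ->
     dyadic j l.+1 <= dyadic m k.+2 :> R ->
     `|f (dyadic j l.+1) - f (dyadic j l)| <= (2^-1 `^ g) ^+ j) ->
  exists C r, 0 < r /\ forall t u, nonneg_ball t0 r t -> nonneg_ball t0 r u ->
    `|f t - f u| <= C * `|t - u| `^ g0.
Proof.
move=> t00 gt0 g0g cf m k J boxI ballbox hJ.
pose J' := maxn J m.
have [||C' C'0 hC] := @dyadic_chaining R f m k.-1 k.+2 J' g gt0 (leq_maxr _ _).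
- move=> t e /andP[t1 t2] e0.
  have It : I t by apply: boxI; rewrite t1 ltW.
  have [s s0 hs] := within_continuous_eps cf It e0.
  exists s => // u /andP[u1 u2] us; apply: hs => //.
  by apply: boxI; rewrite u1 ltW.
- by move=> j l Jj; apply: hJ; rewrite (leq_trans _ Jj)// leq_maxl.
(* Two points of a ball of this radius are at distance less than [2^-1 ^+ J'], the range of the
   chaining bound. *)
have r0 : 0 < 2^-1 ^+ J'.+1 :> R by exact: pow_half_gt0.
exists C', (2^-1 ^+ J'.+1); split => // t u tB uB.
have rm : 2^-1 ^+ J'.+1 <= 2^-1 ^+ m :> R.
  apply: ler_wiXn2l; rewrite ?invr_ge0// ?invf_le1// ?ler1n//.
  by rewrite ltnW// ltnS leq_maxr.
have tu : `|t - u| <= 2^-1 ^+ J'.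
  rewrite ltW// (lt_le_trans (nonneg_ball_dist tB uB))// exprS mulrA divff// mul1r//.
have [->|ne] := eqVneq t u; first by rewrite !subrr normr0 mulr_ge0// powR_ge0.
apply: (le_trans (hC t u _ _ tu)).
- exact/ballbox/(nonneg_ballS rm).
- exact/ballbox/(nonneg_ballS rm).
rewrite ler_wpM2l//; apply: ger_powR => //.
rewrite normr_gt0 subr_eq0 ne/= (le_trans tu)//.
by rewrite exprn_ile1 ?invr_ge0// invf_le1// ler1n.
Qed.

(** The grid point of level [j] just below [t0] and its whole fan lie within [2 * 2^-1 ^+ j] of
    [t0]. An oscillation of order [beta > alpha] at [t0] would thus make all these increments small
    at every large level, which the estimate forbids at every grid point of the box. *)
Lemma path_oscillation (f : R -> R) (t0 alpha beta : R) (n q m k J : nat) :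
  0 <= t0 -> 0 < alpha -> alpha < beta ->
  dyadic m k <= t0 < dyadic m k.+1 ->
  (forall j l, (J <= j)%N -> dyadic m k.-1 <= dyadic j l :> R ->
     dyadic j l.+1 <= dyadic m k.+2 :> R ->
     ~ forall i : 'I_n, `|f (fan (2^-1 ^+ q) (dyadic j l) (2^-1 ^+ j) i) - f (dyadic j l)|
         <= (2^-1 ^+ j) `^ alpha) ->
  ~ limsup_finite f t0 (fun _ rho => rho `^ beta).
Proof.
move=> t00 al0 alb /andP[k1 k2] hJ /limsup_finiteP[C [r [r0 hC]]].
pose C1 := Num.max C 0 * 2 `^ beta + 1.
have C0 : 0 <= Num.max C 0 by rewrite le_max lexx orbT.
have C10 : 0 < C1 by rewrite ltr_wpDl// mulr_ge0// powR_ge0.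
have ab0 : 0 < beta - alpha by rewrite subr_gt0.
pose y := C1^-1 `^ (beta - alpha)^-1.
have y0 : 0 < y by rewrite powR_gt0// invr_gt0.
have [j1 hj1] := exists_pow_half_lt y0.
have [j2 hj2] := exists_pow_half_lt (divr_gt0 r0 (ltr0n R 2)).
pose j := maxn (maxn J m) (maxn j1 j2).
have jJ : (J <= j)%N by rewrite /j !leq_max leqnn.
have jm : (m <= j)%N by rewrite /j !leq_max leqnn !orbT.
have jj1 : (j1 <= j)%N by rewrite /j !leq_max leqnn !orbT.
have jj2 : (j2 <= j)%N by rewrite /j !leq_max leqnn !orbT.
have mono i : (i <= j)%N -> 2^-1 ^+ j <= 2^-1 ^+ i :> R.
  by move=> ij; apply: ler_wiXn2l; rewrite ?invr_ge0// ?invf_le1// ?ler1n.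
set p : R := 2^-1 ^+ j; have p0 : 0 < p by exact: pow_half_gt0.
have py : p <= y by exact: le_trans (mono _ jj1) (ltW hj1).
have pr : 2 * p < r.
  have : p < r / 2 by exact: le_lt_trans (mono _ jj2) hj2.
  by rewrite ltr_pdivlMr// mulrC.
have p2 : 0 < 2 * p by rewrite mulr_gt0.
have /andP[l1 l2] := dyadic_floorP j t00; set l := dyadic_floor j t0 in l1 l2.
apply: (hJ j l jJ).
- have kj : dyadic m k <= dyadic j l :> R.
    have e : dyadic m k = dyadic j (k * 2 ^ (j - m)) :> R.
      by rewrite -(dyadic_refine m (j - m)) subnKC.
    by rewrite e dyadic_le dyadic_floor_ge// -e.
  by rewrite (le_trans _ kj)// dyadic_le leq_pred.
- rewrite !dyadic_succ; rewrite dyadic_succ in k2.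
  by have := mono m jm; rewrite -/p => pm; lra.
move=> i; rewrite -/p; set u := fan _ _ _ _; set t := dyadic j l.
have q0 : 0 <= 2^-1 ^+ q :> R by rewrite exprn_ge0// invr_ge0.
have q1 : 2^-1 ^+ q <= 1 :> R by rewrite exprn_ile1 ?invr_ge0// invf_le1// ler1n.
have l3 : 0 <= (2^-1 ^+ q) ^+ i :> R by exact: exprn_ge0.
have l4 : (2^-1 ^+ q) ^+ i <= 1 :> R by exact: exprn_ile1.
have up : 0 <= u - t <= p.
  have -> : u - t = (2^-1 ^+ q) ^+ i * p by rewrite /u /fan addrAC subrr add0r.
  by rewrite mulr_ge0 ?(ltW p0)// ler_piMl// ltW.
have tp : 0 <= t by exact: dyadic_ge0.
have /andP[up1 up2] := up.
have tB : nonneg_ball t0 (2 * p) t.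
  apply/nonneg_ballE; split => //; rewrite ltr_norml; apply/andP.
  by split; rewrite -/t -/p in l1 l2; lra.
have uB : nonneg_ball t0 (2 * p) u.
  apply/nonneg_ballE; split; last by lra.
  by rewrite ltr_norml; apply/andP; split; rewrite -/t -/p in l1 l2; lra.
have [->|ut] := eqVneq u t; first by rewrite subrr normr0 powR_ge0.
have := hC (2 * p) p2 pr u t uB tB ut.
rewrite ler_pdivrMr ?powR_gt0// => h1; apply: (le_trans h1).
rewrite powRM ?(ltW p0)// mulrA.
apply: (@le_trans _ _ (C1 * p `^ beta)).
  rewrite ler_wpM2r ?powR_ge0// /C1 (@le_trans _ _ (Num.max C 0 * 2 `^ beta))//.
    by rewrite ler_wpM2r ?powR_ge0// le_max lexx.
  by rewrite lerDl.
have -> : p `^ beta = p `^ (beta - alpha) * p `^ alpha.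
  by rewrite -powRD ?subrK//; apply/implyP => _; rewrite gt_eqF.
rewrite mulrA ler_piMl ?powR_ge0//.
apply: (@le_trans _ _ (C1 * y `^ (beta - alpha))).
  by rewrite ler_pM2l//; apply: ge0_ler_powR; rewrite ?nnegrE ?(ltW p0) ?(ltW y0) ?(ltW ab0).
rewrite /y -powRrM mulVf ?powRr1 ?invr_ge0 ?(ltW C10) ?gt_eqF//.
by rewrite mulfV// gt_eqF.
Qed.

End sample_paths.

Theorem theorem4p6 (R : realType) (d : measure_display) (T : measurableType d)
    (P : probability T R) (W : set R -> {RV P >-> R}) (H : R -> R)
    (X : R -> {RV P >-> R}) (I : set R)
    (W_white : white_noise W)
    (H_01 : forall t, 0 <= t -> 0 < H t < 1)
    (X_mBm : mBm W H X)
    (I_open : open_interval_nonneg I)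
    (X_cont : {ae P, forall w, {within I, continuous (fun t => X t w)}})
    (X_var : forall t0, I t0 -> incremental_variance H X t0)
    (H_beta : forall t, I t -> ((H t)%:E < local_exponent H t)%E) :
  {ae P, forall w, forall t0, I t0 ->
     frontier_graph (fun t => X t w) t0 `&` region_D
     = [set p : R * R | p.2 = H t0 + p.1] `&` region_D} /\
  {ae P, forall w, forall t0, I t0 ->
     pointwise_exponent (fun t => X t w) t0 = (H t0)%:E /\
     local_exponent (fun t => X t w) t0 = (H t0)%:E}.
Proof.
have Xw (t : R) : 0 <= t -> wiener W (X t) by exact: (mBm_wiener W_white X_mBm).
have X2 (t : R) : 0 <= t -> L2 P (X t) by move=> /Xw; exact: (wiener_L2 W_white).
have [_ [U [U_open IE]]] := I_open.
have I_nonneg (t : R) : I t -> 0 <= t by rewrite IE => -[].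
have I_ball (t0 : R) : I t0 -> exists2 r, 0 < r & forall t, nonneg_ball t0 r t -> I t.
  rewrite IE => -[Ut0 _]; have := open_nbhs_nbhs (conj U_open Ut0).
  rewrite -nbhs_ballE => -[r /= r0 hr]; exists r => // t [tB tp]; split => //.
  exact: hr.
(* A deterministic condition. The real constant [C] is quantified inside it, which keeps the index
   set countable. *)
pose kcond (i : nat * nat * rat * rat) := let: (m, k, h, g) := i in
  ratr g < ratr h :> R /\ exists2 C : R, 0 < C &
  forall t u, dyadic m k.-1 <= t <= dyadic m k.+2 -> dyadic m k.-1 <= u <= dyadic m k.+2 ->
    incr_var X t u <= C * `|t - u| `^ (2 * ratr h).
pose kconcl (i : nat * nat * rat * rat) w := let: (m, k, h, g) := i in
  exists J, forall j l, (J <= j)%N -> dyadic m k.-1 <= dyadic j l :> R ->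
    dyadic j l.+1 <= dyadic m k.+2 :> R ->
    `|X (dyadic j l.+1) w - X (dyadic j l) w| <= (2^-1 `^ (ratr g)) ^+ j.
have kae : {ae P, forall w, forall i, kcond i -> kconcl i w}.
  apply: ae_forall_countable => -[[[m k] h] g].
  have [hc|hc] := pselect (kcond (m, k, h, g)); last by apply: aeW => w /hc.
  have [gh [C C0 hC]] := hc.
  by apply: filterS (kolmogorov_ae W_white Xw gh C0 hC) => w hw _.
pose ocond (i : nat * nat * nat * nat * rat * rat) := let: (m, k, n, q, h, al) := i in
  2 <= (ratr al - ratr h) * n%:R :> R /\ exists2 c : R, 0 < c &
  forall t rho, dyadic m k.-1 <= t -> t + rho <= dyadic m k.+2 -> 0 < rho ->
  forall x : 'I_n -> R, (c * rho `^ (ratr h)) ^+ 2 * \sum_i x i ^+ 2 <=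
    msq P (fun w => \sum_i x i * (X (fan (2^-1 ^+ q) t rho i) w - X t w)).
pose oconcl (i : nat * nat * nat * nat * rat * rat) w := let: (m, k, n, q, h, al) := i in
  exists J, forall j l, (J <= j)%N -> dyadic m k.-1 <= dyadic j l :> R ->
    dyadic j l.+1 <= dyadic m k.+2 :> R ->
    ~ forall i : 'I_n, `|X (fan (2^-1 ^+ q) (dyadic j l) (2^-1 ^+ j) i) w -
      X (dyadic j l) w| <= (2^-1 ^+ j) `^ (ratr al).
have oae : {ae P, forall w, forall i, ocond i -> oconcl i w}.
  apply: ae_forall_countable => -[[[[[m k] n] q] h] al].
  have [hc|hc] := pselect (ocond (m, k, n, q, h, al)); last by apply: aeW => w /hc.
  have [ah [c c0 hC]] := hc.
  by apply: filterS (oscillation_ae W_white Xw c0 ah hC) => w hw _.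
have main : {ae P, forall w, forall t0, I t0 ->
    (forall g : R, g < H t0 -> exists C r, 0 < r /\
      forall t u, nonneg_ball t0 r t -> nonneg_ball t0 r u ->
      `|X t w - X u w| <= C * `|t - u| `^ g) /\
    (forall alpha : R, H t0 < alpha ->
      ~ limsup_finite (fun t => X t w) t0 (fun _ rho => rho `^ alpha))}.
  (* The three almost sure events do not mention [t0]; from here on [w] is fixed and [t0]
     arbitrary. *)
  apply: filterS3 X_cont kae oae => w cw kw ow t0 It0.
  have t00 := I_nonneg _ It0; have [r r0 rI] := I_ball _ It0.
  have /andP[Ht0 _] := H_01 _ t00.
  split=> [g gH|alpha alH].
    (* The rationals satisfy [max g 0 < g1 < h1 < H t0]: [h1] for the variance, [g1] for the paths,
       positive as chaining requires. *)
    have gH' : Num.max g 0 < H t0 by rewrite gt_max gH.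
    have [g1 /[!in_itv]/= /andP[gg1 g1H]] := rat_in_itvoo gH'.
    have [h1 /[!in_itv]/= /andP[gh1 h1H]] := rat_in_itvoo g1H.
    move: gg1; rewrite gt_max => /andP[gg1 g10].
    have [C [r1 [C0 r10 hC]]] := incr_var_le H_01 X2 t00 (X_var _ It0) (H_beta _ It0) h1H.
    have rr : 0 < Num.min r r1 by rewrite lt_min r0.
    have [m [k [b1 b2 _]]] := box_around t00 rr.
    have [J hJ] : kconcl (m, k, h1, g1) w.
      apply: kw; split => //; exists C => // t u tb ub; apply: hC.
        by apply: nonneg_ballS (b1 t tb); rewrite ge_min lexx orbT.
      by apply: nonneg_ballS (b1 u ub); rewrite ge_min lexx orbT.
    apply: (path_holder t00 g10 (ltW gg1) cw _ b2 hJ).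
    by move=> t /b1 tB; apply/rI/(nonneg_ballS _ tB); rewrite ge_min lexx.
  (* Now [H t0 < h1 < a1 < alpha]: the gap from [h1] to [a1] determines [n], the one from [a1] to
     [alpha] absorbs the constant of the limsup. *)
  have [h1 /[!in_itv]/= /andP[Hh1 h1al]] := rat_in_itvoo alH.
  have [a1 /[!in_itv]/= /andP[ha1 a1al]] := rat_in_itvoo h1al.
  have ah0 : 0 < ratr a1 - ratr h1 :> R by rewrite subr_gt0.
  pose n := (Num.truncn (2 / (ratr a1 - ratr h1) : R)).+1.
  have n2 : 2 <= (ratr a1 - ratr h1) * n%:R :> R.
    by rewrite mulrC -ler_pdivrMr// ltW// truncnS_gt.
  have [q [c [r1 [c0 r10 hq]]]] :=
    local_nondeterminism H_01 X2 t00 (X_var _ It0) (H_beta _ It0) n Hh1.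
  have [m [k [b1 b2 b3]]] := box_around t00 r10.
  have [J hJ] : oconcl (m, k, n, q, h1, a1) w.
    apply: ow; split => //; exists c => // t rho t1 t2 rho0; apply: hq => //.
      by apply: b1; rewrite t1 (le_trans _ t2)// lerDl ltW.
    by apply: b1; rewrite t2 andbT (le_trans t1)// lerDl ltW.
  apply: (path_oscillation t00 _ a1al b3 hJ).
  exact: lt_trans Ht0 (lt_trans Hh1 ha1).
split.
  apply: filterS main => w hw t0 It0; have [hh ho] := hw t0 It0.
  by apply: frontier_graph_line => //; case/andP: (H_01 _ (I_nonneg _ It0)).
apply: filterS main => w hw t0 It0; have [hh ho] := hw t0 It0.
have /andP[h0 _] := H_01 _ (I_nonneg _ It0).
by split; [exact: pointwise_exponentE|exact: local_exponentE].
Qed.
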